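(* Let $S>0$ and let $\alpha_0=\alpha_0(S)<0$ be a constant with the following property: for every $\alpha\in[\alpha_0,0)$ the equilateral triangle is a strict local maximiser of the lowest Robin eigenvalue in the family of triangles of area $S$, and there exist $\varepsilon>0$ and $C>0$ such that $\lambda_1^\alpha(\Omega_{a,c})\le\lambda_1^\alpha(\Omega_0)-C\left(a^2+(c-c_0)^2\right)$ whenever $|a|+|c-c_0|<\varepsilon$. Then, for every boundary parameter $\alpha\in(\alpha_0,0)$, the equilateral triangle is a strict local maximiser of the lowest Robin eigenvalue in the family of triangles of fixed perimeter $2\sqrt{3\sqrt3\,S}$.
   Context: For a bounded Lipschitz domain $\Omega\subset\mathbb{R}^2$ and $\alpha\in\mathbb{R}$, the lowest Robin eigenvalue is $$\lambda_1^\alpha(\Omega)=\inf_{u\in H^1(\Omega),\,u\neq0}\frac{\int_\Omega|\nabla u|^2+\alpha\int_{\partial\Omega}|u|^2}{\int_\Omega|u|^2},$$ with the boundary integral understood in the sense of traces. Fix $S>0$. For $a\in\mathbb{R}$ and $c>0$, $\Omega_{a,c}$ denotes the (open) triangle with vertices $(-c,0)$, $(c,0)$ and $(a,S/c)$; it has area $S$, and every triangle of area $S$ is congruent to some $\Omega_{a,c}$. Put $c_0:=\sqrt{S/\sqrt3}$; then $\Omega_0:=\Omega_{0,c_0}$ is the equilateral triangle of area $S$, whose perimeter is $|\partial\Omega_0|=6\sqrt{S/\sqrt3}=2\sqrt{3\sqrt3\,S}$. ''Strict local maximiser in the family of triangles of area $S$'' means that there is a neighbourhood of $(0,c_0)$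 in $\mathbb{R}\times(0,\infty)$ such that $\lambda_1^\alpha(\Omega_{a,c})<\lambda_1^\alpha(\Omega_0)$ for all $(a,c)\neq(0,c_0)$ in it. With $\gamma_{a,c}:=|\partial\Omega_0|/|\partial\Omega_{a,c}|$, the map $(a,c)\mapsto\gamma_{a,c}\Omega_{a,c}$ parameterises (up to congruence) the triangles with the same perimeter as $\Omega_0$; ''strict local maximiser in the family of triangles of fixed perimeter $2\sqrt{3\sqrt3\,S}$'' means that there is a neighbourhood of $(0,c_0)$ such that $\lambda_1^\alpha(\gamma_{a,c}\Omega_{a,c})<\lambda_1^\alpha(\Omega_0)$ for all $(a,c)\neq(0,c_0)$ in it. *)

(* Defs.v *)
From HB Require Import structures.
From mathcomp Require Import all_boot all_order all_algebra.
From mathcomp Require Import all_classical all_reals all_analysis.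

Set Implicit Arguments.
Unset Strict Implicit.
Unset Printing Implicit Defensive.

Import Order.TTheory GRing.Theory Num.Theory.
Import numFieldNormedType.Exports.

Local Open Scope classical_set_scope.
Local Open Scope ring_scope.

Section SmoothFunctions.
Context {R : realType}.
Implicit Types (phi : R * R -> R) (x : R * R).

Definition partial1 phi x : R := derive1 (fun t : R => phi (t, x.2)) x.1.
Definition partial2 phi x : R := derive1 (fun t : R => phi (x.1, t)) x.2.

Fixpoint Ck (k : nat) phi : Prop :=
  continuous phi /\
  if k is k'.+1 then
    [/\ forall x, derivable (fun t : R => phi (t, x.2)) x.1 1,
        forall x, derivable (fun t : R => phi (x.1, t)) x.2 1,
        Ck k' (partial1 phi) & Ck k' (partial2 phi)]
  else True.

Definition smooth phi : Prop := forall k, Ck k phi.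

Definition test_function (D : set (R * R)) phi : Prop :=
  smooth phi /\
  exists K : set (R * R),
    [/\ compact K, K `<=` D & forall x, ~ K x -> phi x = 0].

End SmoothFunctions.

Section Triangles.
Context {R : realType}.

Record triangle := Triangle { vtxA : R * R; vtxB : R * R; vtxC : R * R }.

Implicit Types (T : triangle) (p q : R * R).

(* Strictly positive barycentric coordinates: for a non-degenerate T this is
   the interior of the convex hull of the vertices. *)
Definition open_triangle T : set (R * R) :=
  [set x | exists s : R * R * R,
     [/\ [/\ 0 < s.1.1, 0 < s.1.2 & 0 < s.2],
         s.1.1 + s.1.2 + s.2 = 1,
         x.1 = s.1.1 * (vtxA T).1 + s.1.2 * (vtxB T).1 + s.2 * (vtxC T).1 &
         x.2 = s.1.1 * (vtxA T).2 + s.1.2 * (vtxB T).2 + s.2 * (vtxC T).2]].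

Definition segment_length p q : R :=
  Num.sqrt ((q.1 - p.1) ^+ 2 + (q.2 - p.2) ^+ 2).

Definition segment_point p q (t : R) : R * R :=
  (p.1 + t * (q.1 - p.1), p.2 + t * (q.2 - p.2)).

Definition perimeter T : R :=
  segment_length (vtxA T) (vtxB T) + segment_length (vtxB T) (vtxC T)
  + segment_length (vtxC T) (vtxA T).

Definition dilate_point (k : R) p : R * R := (k * p.1, k * p.2).

Definition dilate (k : R) T : triangle :=
  Triangle (dilate_point k (vtxA T)) (dilate_point k (vtxB T))
           (dilate_point k (vtxC T)).

End Triangles.
Arguments triangle : clear implicits.

Section Sobolev.
Context {R : realType}.
Implicit Types (T : triangle R) (D : set (R * R)) (u v g phi : R * R -> R).

Definition area_measure := (@lebesgue_measure R \x @lebesgue_measure R)%E.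

Definition sqnorm D u : \bar R :=
  (\int[area_measure]_(x in D) ((u x) ^+ 2)%:E)%E.

Definition in_L2 D u : Prop := measurable_fun D u /\ (sqnorm D u < +oo)%E.

(* (v1, v2) is the distributional gradient of u on D. *)
Definition weak_gradient D u v1 v2 : Prop :=
  forall phi, test_function D phi ->
    (\int[area_measure]_(x in D) (u x * partial1 phi x)%:E
       = - \int[area_measure]_(x in D) (v1 x * phi x)%:E)%E /\
    (\int[area_measure]_(x in D) (u x * partial2 phi x)%:E
       = - \int[area_measure]_(x in D) (v2 x * phi x)%:E)%E.

Definition sobolev_H1 D u v1 v2 : Prop :=
  [/\ in_L2 D u, in_L2 D v1, in_L2 D v2 & weak_gradient D u v1 v2].

Definition unit_interval : set R := `[0%R, 1%R]%classic.

(* Squared L2 norm of g on the side [p, q] with respect to arc length. *)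
Definition side_sqnorm (p q : R * R) g : \bar R :=
  ((segment_length p q)%:E *
   \int[lebesgue_measure]_(t in unit_interval) ((g (segment_point p q t)) ^+ 2)%:E)%E.

Definition boundary_sqnorm T g : \bar R :=
  (side_sqnorm (vtxA T) (vtxB T) g + side_sqnorm (vtxB T) (vtxC T) g
   + side_sqnorm (vtxC T) (vtxA T) g)%E.

Definition in_L2_boundary T g : Prop :=
  [/\ measurable_fun unit_interval (g \o segment_point (vtxA T) (vtxB T)),
      measurable_fun unit_interval (g \o segment_point (vtxB T) (vtxC T)),
      measurable_fun unit_interval (g \o segment_point (vtxC T) (vtxA T)) &
      (boundary_sqnorm T g < +oo)%E].

(* g is the trace of u on the boundary of T. The trace operator on H^1 is the
   continuous extension of the restriction of functions smooth up to the
   boundary, so g is the L2 limit on the boundary of restrictions of smooth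
   functions that converge to u in H^1. *)
Definition is_trace T u v1 v2 g : Prop :=
  in_L2_boundary T g /\
  exists phi : nat -> R * R -> R,
    let D := open_triangle T in
    [/\ forall n, smooth (phi n),
        sqnorm D (phi n \- u) @[n --> \oo] --> (0 : \bar R)%E,
        sqnorm D (partial1 (phi n) \- v1) @[n --> \oo] --> (0 : \bar R)%E,
        sqnorm D (partial2 (phi n) \- v2) @[n --> \oo] --> (0 : \bar R)%E &
        boundary_sqnorm T (phi n \- g) @[n --> \oo] --> (0 : \bar R)%E].

Definition rayleigh_quotient (alpha : R) T u v1 v2 g : R :=
  let D := open_triangle T in
  (fine (sqnorm D v1 + sqnorm D v2)%E + alpha * fine (boundary_sqnorm T g))
  / fine (sqnorm D u).

(* The value is extended real, so that it is a genuine infimum whether or not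
   the set of quotients is bounded below. Functions are representatives of
   their L2 classes; v1, v2 and g are determined by u up to null sets. *)
Definition lambda1 (alpha : R) T : \bar R :=
  let D := open_triangle T in
  ereal_inf [set r | exists u, exists v1, exists v2, exists g,
    [/\ sobolev_H1 D u v1 v2, ~ ae_eq area_measure D u (cst 0), is_trace T u v1 v2 g &
        r = (rayleigh_quotient alpha T u v1 v2 g)%:E]].

End Sobolev.

Section Families.
Context {R : realType}.

Definition Omega (S a c : R) : triangle R :=
  Triangle (- c, 0) (c, 0) (a, S / c).

Definition c_eq (S : R) : R := Num.sqrt (S / Num.sqrt 3).

Definition Omega0 (S : R) : triangle R := Omega S 0 (c_eq S).

Definition gamma (S a c : R) : R := perimeter (Omega0 S) / perimeter (Omega S a c).

Definition strict_local_maximiser (x0 : R * R) (m : \bar R)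
    (F : R -> R -> \bar R) : Prop :=
  \forall x \near x0, 0 < x.2 -> x != x0 -> (F x.1 x.2 < m)%E.

Definition strict_local_max_area (S alpha : R) : Prop :=
  strict_local_maximiser (0, c_eq S) (lambda1 alpha (Omega0 S))
    (fun a c => lambda1 alpha (Omega S a c)).

Definition strict_local_max_perimeter (S alpha : R) : Prop :=
  strict_local_maximiser (0, c_eq S) (lambda1 alpha (Omega0 S))
    (fun a c => lambda1 alpha (dilate (gamma S a c) (Omega S a c))).

End Families.

(* Main.v *)
Require Import Defs.
From mathcomp Require Import all_boot all_order all_algebra.
From mathcomp Require Import all_classical all_reals all_analysis measurable_realfun.
From mathcomp Require Import ring lra.

(** The perimeter is smallest at the equilateral triangle among all triangles of
    area S, and close to it the excess is at most of the order of the squared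
    distance D = a ^ 2 + (c - c0) ^ 2. So the factor gamma = 1 - e satisfies
    0 <= e <= K1 * D. Let s = - alpha and - k2 = lambda1 alpha Omega0, and write
    En, B, M for the energy, the boundary integral of f ^ 2 and the area integral
    of f ^ 2. A dilation by gamma leaves En unchanged, multiplies B by gamma and M
    by gamma ^ 2. Hence, if f is a near-minimiser for alpha on the triangle T of
    area S, for which En - s B < (- k2 - C D / 2) M by the quadratic estimate, its
    dilation is a good test function on the dilated triangle as soon as
    e s B - C D / 2 M <= (1 - (1 - e) ^ 2) k2 M. To first order in e this asks for
    s B <= 2 k2 M; as e <= K1 D, an excess that is small compared with C is
    absorbed by C D / 2.

    The bound on B comes from a second parameter s' > s. If En >= s' B - k2' M
    holds on T, up to small errors, then subtracting it from the estimate for s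
    leaves (s' - s) B <= (k2' - k2) M. On the equilateral triangle the lowest
    eigenvalue is explicit ([lambda1_equilateral]): k2 = s ^ 2 / rho ^ 2, where
    rho increases with s ([robin_param_lt_inv]). Therefore k2' <= s' ^ 2 / rho ^ 2
    and B <= (s + s') / rho ^ 2 M, which tends to 2 k2 M / s as s' tends to s.

    Both the explicit eigenvalue and the lower bound on T follow from Barta's
    method ([barta_identity]). The ground state u of the equilateral triangle is a
    sum of three hyperbolic cosines, each of an affine function of the distance to
    one side. The field
    X = grad u / u has normal component s on the sides, and
    div X + |X| ^ 2 = k2, so expanding |grad f - f X| ^ 2 >= 0 with the divergence
    theorem gives En >= s B - k2 M, with equality for u. Written in barycentric
    coordinates the field makes sense on every triangle, and on those close to
    Omega0 it gives the inequality with small errors ([near_barta]).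

    All this is done for smooth f: by definition of the trace, near-minimisers
    among Sobolev functions can be replaced by smooth ones ([smooth_below]), and
    smooth functions are admissible ([lambda1_le_smooth]). Integrals over triangles
    are carried to one reference simplex ([integral_triangle]), where the
    divergence theorem is Fubini's theorem together with the fundamental theorem of
    calculus ([simplex_divergence]). *)

Set Implicit Arguments.
Unset Strict Implicit.
Unset Printing Implicit Defensive.
Import Order.TTheory GRing.Theory Num.Theory.
Import numFieldNormedType.Exports.
Local Open Scope classical_set_scope.
Local Open Scope ring_scope.

(** * Measurability and affine changes of variables *)

Lemma continuous_comp_pair (T : topologicalType) (R : realType) (F : R * R -> R) (f g : T -> R) :
  continuous F -> continuous f -> continuous g ->
  continuous (fun t => F (f t, g t)).
Proof.
move=> cF cf cg t; apply: (@continuous_comp _ _ _ (fun t => (f t, g t)) F); last exact: cF.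
move=> A; exact: (@cvg_pair _ _ _ _ (nbhs (f t)) (nbhs (g t)) _ _ _ f g (cf t) (cg t) A).
Qed.

Section plane_measure.
Context {R : realType}.
Local Notation mu := (@lebesgue_measure R).

(** The product sigma-algebra is generated by rectangles, so an open set is written
    as the union of the countably many rational boxes that it contains. *)
Lemma open_measurable2 (U : set (R * R)) : open U -> measurable U.
Proof.
move=> oU.
pose box (q : rat * rat * (rat * rat)) : set (R * R) :=
  `]ratr q.1.1, ratr q.1.2[%classic `*` `]ratr q.2.1, ratr q.2.2[%classic.
have -> : U = \bigcup_(q in [set q | box q `<=` U]) box q.
  apply/seteqP; split=> [[x y] Uxy|]; last by move=> xy [q qU qxy]; exact: qU.
  have /nbhs_ballP[e /= e0 eU] : nbhs (x, y) U by exact: open_nbhs_nbhs.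
  have ex (z : R) : exists a b : rat, [/\ z - e < ratr a, ratr a < z, z < ratr b & ratr b < z + e].
    have [a /=] := @rat_in_itvoo R (z - e) z ltac:(lra).
    have [b /=] := @rat_in_itvoo R z (z + e) ltac:(lra).
    by rewrite !in_itv/= => /andP[? ?] /andP[? ?]; exists a, b.
  have [a1 [b1 [h1 h2 h3 h4]]] := ex x.
  have [a2 [b2 [g1 g2 g3 g4]]] := ex y.
  exists (a1, b1, (a2, b2)); last by split; rewrite /= in_itv/= ?h2 ?g2.
  move=> [u v] [/=]; rewrite !in_itv/= => /andP[? ?] /andP[? ?].
  apply: eU; split; rewrite /ball/= ltr_distlC; apply/andP; split; lra.
rewrite bigcup_mkcond; apply: countable_bigcupT_measurable => [|q].
  exact: countableP.
by case: ifPn => // _; apply: measurableX; exact: measurable_itv.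
Qed.

Lemma continuous_measurable2 (D : set (R * R)) (f : R * R -> R) :
  continuous f -> measurable_fun D f.
Proof.
move=> /continuousP cf; apply: measurable_funTS; apply: (measurability _ (RGenOInfty.measurableE R)).
move=> _ [_ [a ->] <-]; rewrite setTI; apply: open_measurable2.
apply: cf; rewrite set_itv_o_infty; exact: open_gt.
Qed.

(** Lebesgue measure is determined by its values on intervals, and on those the
    pushforward by an affine map is computed directly. *)
Lemma ge0_integral_affine (m b : R) (f : R -> \bar R) : m != 0 ->
  measurable_fun setT f -> (forall x, 0 <= f x)%E ->
  (\int[mu]_x f x = `|m|%:E * \int[mu]_x f (m * x + b)%R)%E.
Proof.
move=> m0 mf f0; pose g : R -> measurableTypeR R := fun x : R => m * x + b.
have mg : measurable_fun setT g.
  apply: continuous_measurable_fun => x.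
  by apply: cvgD; [apply: cvgM; [exact: cvg_cst|exact: cvg_id]|exact: cvg_cst].
pose pf := measure_function_pushforward__canonical__measure_function_Measure mu mg.
pose nu : {measure set (measurableTypeR R) -> \bar R} := mscale (NngNum (normr_ge0 m)) pf.
have numu A : measurable A -> mu A = nu A.
  move=> mA; refine (@lebesgue_measure_unique R nu _ A mA) => _ [[u v]] _ <-.
  rewrite [RHS](_ : _ = (`|m|%:E * mu (g @^-1` [set` `]u, v]%R]))%E)//.
  rewrite [in LHS]lebesgue_measure_itv/= lte_fin.
  have [mn|mp|m0'] := ltgtP m 0; last by rewrite m0' eqxx in m0.
  - rewrite [X in mu X](_ : _ = `[(v - b) / m, (u - b) / m[%classic); last first.
      apply/seteqP; split => x /=; rewrite !in_itv/= /g ler_ndivrMr// ltr_ndivlMr// => /andP[? ?]; lra.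
    rewrite lebesgue_measure_itv/= lte_fin ltr_nM2r ?invr_lt0// ltrD2r.
    case: ifPn => uv; last by rewrite mule0.
    rewrite ltr0_norm// -!EFinB -EFinM; congr EFin; field; lra.
  - rewrite [X in mu X](_ : _ = `](u - b) / m, (v - b) / m]%classic); last first.
      apply/seteqP; split => x /=; rewrite !in_itv/= /g ler_pdivlMr// ltr_pdivrMr// => /andP[? ?]; lra.
    rewrite lebesgue_measure_itv/= lte_fin ltr_pM2r ?invr_gt0// ltrD2r.
    case: ifPn => uv; last by rewrite mule0.
    rewrite gtr0_norm// -!EFinB -EFinM; congr EFin; field; lra.
rewrite (eq_measure_integral nu) => [|A mA _]; last exact: numu.
rewrite ge0_integral_mscale//.
by rewrite ge0_integral_pushforward.
Qed.

End plane_measure.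

(** * Integration over the reference simplex *)

Section ref_simplex.
Context {R : realType}.
Local Notation mu := (@lebesgue_measure R).
Local Notation area := (@area_measure R).

Lemma area_box_fin (a b c d : R) : (area (`[a, b] `*` `[c, d]) < +oo)%E.
Proof.
rewrite /area_measure product_measure1E//.
rewrite /= !lebesgue_measure_itv/=.
by case: ifPn => _; case: ifPn => _; rewrite ?mule0 ?mul0e// -!EFinB -EFinM ltry.
Qed.

Lemma continuous_box_integrable (D : set (R * R)) (a b c d : R) (f : R * R -> R) :
  measurable D -> D `<=` `[a, b] `*` `[c, d] -> continuous f ->
  area.-integrable D (EFin \o f).
Proof.
move=> mD Dbox cf; have mbox : measurable (`[a, b]%classic `*` `[c, d]%classic : set (R * R)).
  by apply: measurableX; exact: measurable_itv.
apply: (@integrableS _ _ _ area (`[a, b]%classic `*` `[c, d]%classic)) => //.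
apply: measurable_bounded_integrable => //.
- exact: area_box_fin.
- exact: continuous_measurable2.
- have : compact (f @` (`[a, b]%classic `*` `[c, d]%classic)).
    apply: continuous_compact; first exact: continuous_subspaceT.
    by apply: compact_setX; exact: segment_compact.
  move=> /compact_bounded [M [rM hM]]; exists M; split=> // N MN x bx; apply: (hM N MN); by exists x.
Qed.

(** The pair (p, q) stands for the point with barycentric coordinates
    (1 - p - q, p, q) of a triangle, so that one set of coordinates serves all
    triangles. *)
Definition simplex : set (R * R) := [set z | [/\ 0 < z.1, 0 < z.2 & z.1 + z.2 < 1]].

Lemma continuous_fst2 : continuous (fun z : R * R => z.1).
Proof. by move=> z; exact: cvg_fst. Qed.

Lemma continuous_snd2 : continuous (fun z : R * R => z.2).
Proof. by move=> z; exact: cvg_snd. Qed.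

Lemma measurable_simplex : measurable simplex.
Proof.
have -> : simplex = (fun z : R * R => z.1) @^-1` `]0, +oo[ `&`
   ((fun z : R * R => z.2) @^-1` `]0, +oo[ `&`
   (fun z : R * R => z.1 + z.2) @^-1` `]-oo, 1[).
  by apply/seteqP; split=> [z [? ? ?]|z []] /=; rewrite !in_itv/= ?andbT// => ? [? ?].
have pre (f : R * R -> R) (I : interval R) : continuous f -> measurable (f @^-1` [set` I] ).
  move=> cf; rewrite -[X in measurable X]setTI.
  by apply: (continuous_measurable2 cf); [exact: measurableT|exact: measurable_itv].
apply: measurableI; first by apply: pre; exact: continuous_fst2.
apply: measurableI; first by apply: pre; exact: continuous_snd2.
apply: pre => z; apply: cvgD; [exact: continuous_fst2|exact: continuous_snd2].
Qed.

Lemma simplex_integrable (f : R * R -> R) : continuous f ->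
  area.-integrable simplex (EFin \o f).
Proof.
move=> cf; apply: (@continuous_box_integrable _ 0 1 0 1) => //.
- exact: measurable_simplex.
- by move=> z [? ? ?]; split; rewrite /= in_itv/=; lra.
Qed.

Definition simplex_int (f : R * R -> R) : R := \int[area]_(z in simplex) f z.
Definition unit_int (g : R -> R) : R := \int[mu]_(t in unit_interval) g t.

Lemma simplex_intE f : continuous f -> (\int[area]_(z in simplex) (f z)%:E = (simplex_int f)%:E)%E.
Proof.
move=> cf; rewrite /simplex_int /Rintegral fineK//; apply: integrable_fin_num.
  exact: measurable_simplex.
exact: simplex_integrable.
Qed.

Lemma unit_integrable (g : R -> R) : continuous g -> mu.-integrable unit_interval (EFin \o g).
Proof.
move=> cg; apply: continuous_compact_integrable; first exact: segment_compact.
exact: continuous_subspaceT.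
Qed.

Lemma unit_intE g : continuous g -> (\int[mu]_(t in unit_interval) (g t)%:E = (unit_int g)%:E)%E.
Proof.
move=> cg; rewrite /unit_int /Rintegral fineK//; apply: integrable_fin_num => //.
  exact: measurable_itv.
exact: unit_integrable.
Qed.

Lemma continuous_pair1 (f : R * R -> R) (y : R) : continuous f -> continuous (fun t => f (t, y)).
Proof. by move=> cf; apply: continuous_comp_pair => // t; [exact: cvg_id|exact: cvg_cst]. Qed.

Lemma continuous_pair2 (f : R * R -> R) (x : R) : continuous f -> continuous (fun t => f (x, t)).
Proof. by move=> cf; apply: continuous_comp_pair => // t; [exact: cvg_cst|exact: cvg_id]. Qed.

(** Fubini, then the fundamental theorem of calculus on the sections ]0, 1 - q[. *)
Lemma simplex_int_partial1 (f f1 : R * R -> R) : continuous f -> continuous f1 ->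
  (forall z : R * R, is_derive z.1 1 (fun t => f (t, z.2)) (f1 z)) ->
  simplex_int f1 = unit_int (fun t => f (1 - t, t) - f (0, t)).
Proof.
move=> cf cf1 df; apply: EFin_inj; rewrite -simplex_intE// integral_mkcond.
have if1 := simplex_integrable cf1.
rewrite -[LHS]integral21_prod_meas1; last first.
  by rewrite -integrable_mkcond; [exact: if1|exact: measurable_simplex].
transitivity (\int[mu]_(t in `]0%R, 1%R[) (f (1 - t, t)%R - f (0, t)%R)%:E)%E.
  rewrite [RHS]integral_mkcond; apply: eq_integral => q _.
  rewrite [RHS]patchE; case: ifPn => [|]; rewrite ?inE ?notin_setE /= in_itv/= => hq.
    transitivity (\int[mu]_(p in `]0%R, (1 - q)%R[) (f1 (p, q))%:E)%E.
      rewrite /fubini_G [RHS]integral_mkcond; apply: eq_integral => p _.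
      rewrite !patchE; congr (if _ then _ else _); apply/idP/idP; rewrite !inE /simplex/= in_itv/=.
        by move=> [? ? ?]; lra.
      by move=> ?; split; lra.
    rewrite -(@integral_itv_bndoo _ _ _ _ true false); last first.
      apply/measurable_EFinP; apply: measurable_funTS; apply: continuous_measurable_fun.
      exact: continuous_pair1.
    rewrite (@continuous_FTC2 _ _ (fun p => f (p, q))) ?EFinB//; first lra.
    - by apply: continuous_subspaceT; exact: continuous_pair1.
    - have c1 := @continuous_pair1 f q cf.
      split.
      + by move=> p _; have [] := df (p, q).
      + by apply: cvg_at_right_filter; exact: c1.
      + by apply: cvg_at_left_filter; exact: c1.
    - by move=> p _; rewrite derive1E; have h := df (p, q); exact: derive_val.
  rewrite /fubini_G integral0_eq// => p _; rewrite patchE ifF//.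
  by apply/negbTE; rewrite notin_setE => -[/= ? ? ?]; apply: hq; lra.
have cg : continuous (fun t : R => f (1 - t, t) - f (0, t)).
  move=> t; apply: cvgB; last exact: continuous_pair2.
  apply: continuous_comp_pair => // u; last exact: cvg_id.
  by apply: cvgB; [exact: cvg_cst|exact: cvg_id].
rewrite -unit_intE// -(@integral_itv_bndoo _ _ _ _ true false)//.
by apply/measurable_EFinP; apply: measurable_funTS; apply: continuous_measurable_fun.
Qed.

Lemma simplex_int_partial2 (f f2 : R * R -> R) : continuous f -> continuous f2 ->
  (forall z : R * R, is_derive z.2 1 (fun t => f (z.1, t)) (f2 z)) ->
  simplex_int f2 = unit_int (fun t => f (t, 1 - t) - f (t, 0)).
Proof.
move=> cf cf2 df; apply: EFin_inj; rewrite -simplex_intE// integral_mkcond.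
have if2 := simplex_integrable cf2.
rewrite -[LHS]integral12_prod_meas1; last first.
  by rewrite -integrable_mkcond; [exact: if2|exact: measurable_simplex].
transitivity (\int[mu]_(t in `]0%R, 1%R[) (f (t, 1 - t)%R - f (t, 0)%R)%:E)%E.
  rewrite [RHS]integral_mkcond; apply: eq_integral => p _.
  rewrite [RHS]patchE; case: ifPn => [|]; rewrite ?inE ?notin_setE /= in_itv/= => hp.
    transitivity (\int[mu]_(q in `]0%R, (1 - p)%R[) (f2 (p, q))%:E)%E.
      rewrite /fubini_F [RHS]integral_mkcond; apply: eq_integral => q _.
      rewrite !patchE; congr (if _ then _ else _); apply/idP/idP; rewrite !inE /simplex/= in_itv/=.
        by move=> [? ? ?]; lra.
      by move=> ?; split; lra.
    rewrite -(@integral_itv_bndoo _ _ _ _ true false); last first.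
      apply/measurable_EFinP; apply: measurable_funTS; apply: continuous_measurable_fun.
      exact: continuous_pair2.
    rewrite (@continuous_FTC2 _ _ (fun q => f (p, q))) ?EFinB//; first lra.
    - by apply: continuous_subspaceT; exact: continuous_pair2.
    - have c1 := @continuous_pair2 f p cf.
      split.
      + by move=> q _; have [] := df (p, q).
      + by apply: cvg_at_right_filter; exact: c1.
      + by apply: cvg_at_left_filter; exact: c1.
    - by move=> q _; rewrite derive1E; have h := df (p, q); exact: derive_val.
  rewrite /fubini_F integral0_eq// => q _; rewrite patchE ifF//.
  by apply/negbTE; rewrite notin_setE => -[/= ? ? ?]; apply: hp; lra.
have cg : continuous (fun t : R => f (t, 1 - t) - f (t, 0)).
  move=> t; apply: cvgB; last exact: continuous_pair1.
  apply: continuous_comp_pair => // u; first exact: cvg_id.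
  by apply: cvgB; [exact: cvg_cst|exact: cvg_id].
rewrite -unit_intE// -(@integral_itv_bndoo _ _ _ _ true false)//.
by apply/measurable_EFinP; apply: measurable_funTS; apply: continuous_measurable_fun.
Qed.

Lemma unit_int_onem (g : R -> R) : continuous g -> unit_int (fun t => g (1 - t)) = unit_int g.
Proof.
move=> cg; have cg' : continuous (fun t : R => g (1 - t)).
  move=> t; apply: (@continuous_comp _ _ _ (fun t : R => 1 - t) g); last exact: cg.
  by apply: cvgB; [exact: cvg_cst|exact: cvg_id].
have := @Rintegration_by_substitution_onem R g 1.
rewrite unstable.onem1 /unit_int /unit_interval => ->//; first by rewrite ler01 lexx.
exact: continuous_subspaceT.
Qed.

Lemma simplex_int_linear (a b : R) f g : continuous f -> continuous g ->
  simplex_int (fun z => a * f z + b * g z) = a * simplex_int f + b * simplex_int g.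
Proof.
move=> cf cg; have cs (k : R) h : continuous h -> continuous (fun z : R * R => k * h z).
  by move=> ch z; apply: cvgM; [exact: cvg_cst|exact: ch].
rewrite /simplex_int RintegralD ?RintegralZl//; try exact: measurable_simplex;
  by apply: simplex_integrable => //; apply: cs.
Qed.

Lemma le_simplex_int f g : continuous f -> continuous g -> (forall z, simplex z -> f z <= g z) -> simplex_int f <= simplex_int g.
Proof.
move=> cf cg fg; apply: le_Rintegral => //; try exact: measurable_simplex; exact: simplex_integrable.
Qed.

Lemma unit_int_linear (a b : R) f g : continuous f -> continuous g ->
  unit_int (fun z => a * f z + b * g z) = a * unit_int f + b * unit_int g.
Proof.
move=> cf cg; have cs (k : R) h : continuous h -> continuous (fun z : R => k * h z).
  by move=> ch z; apply: cvgM; [exact: cvg_cst|exact: ch].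
rewrite /unit_int RintegralD ?RintegralZl//; try exact: measurable_itv;
  by apply: unit_integrable => //; apply: cs.
Qed.

Lemma unit_intD (f g : R -> R) : continuous f -> continuous g ->
  unit_int (fun t => f t + g t) = unit_int f + unit_int g.
Proof.
move=> cf cg; rewrite -[unit_int f]mul1r -[unit_int g]mul1r -unit_int_linear//.
by congr unit_int; apply/funext => t; rewrite !mul1r.
Qed.

Lemma unit_intB (f g : R -> R) : continuous f -> continuous g ->
  unit_int (fun t => f t - g t) = unit_int f - unit_int g.
Proof.
move=> cf cg; rewrite -[unit_int f]mul1r -mulN1r -unit_int_linear//.
by congr unit_int; apply/funext => t; rewrite mul1r mulN1r.
Qed.

Lemma simplex_int_ge0 (f : R * R -> R) : (forall z, 0 <= f z) -> 0 <= simplex_int f.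
Proof. by move=> f0; rewrite /simplex_int; apply: Rintegral_ge0 => z _. Qed.

Lemma simplex_intD (f g : R * R -> R) : continuous f -> continuous g ->
  simplex_int (fun t => f t + g t) = simplex_int f + simplex_int g.
Proof.
move=> cf cg; rewrite -[simplex_int f]mul1r -[simplex_int g]mul1r -simplex_int_linear//.
by congr simplex_int; apply/funext => t; rewrite !mul1r.
Qed.

Lemma simplex_intZ (k : R) (f : R * R -> R) : continuous f ->
  simplex_int (fun t => k * f t) = k * simplex_int f.
Proof.
move=> cf; rewrite -[RHS]addr0 -(mul0r (simplex_int f)) -simplex_int_linear//.
by congr simplex_int; apply/funext => t; rewrite mul0r addr0.
Qed.

Lemma simplex_intB (f g : R * R -> R) : continuous f -> continuous g ->
  simplex_int (fun t => f t - g t) = simplex_int f - simplex_int g.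
Proof.
move=> cf cg; rewrite -[simplex_int f]mul1r -[- simplex_int g]mulN1r -simplex_int_linear//.
by congr simplex_int; apply/funext => t; rewrite mul1r mulN1r.
Qed.

Lemma unit_intZ (k : R) (f : R -> R) : continuous f ->
  unit_int (fun t => k * f t) = k * unit_int f.
Proof.
move=> cf; rewrite -[RHS]addr0 -(mul0r (unit_int f)) -unit_int_linear//.
by congr unit_int; apply/funext => t; rewrite mul0r addr0.
Qed.

End ref_simplex.

(** * Triangles as affine images of the simplex *)

Section triangles.
Context {R : realType}.
Local Notation mu := (@lebesgue_measure R).
Local Notation area := (@area_measure R).

(** This family contains the triangles of area S and is stable under dilation. *)
Definition base_triangle (c a h : R) : triangle R := Triangle (- c, 0) (c, 0) (a, h).
(** The affine map with linear part (B - A, C - A) that sends 0 to the vertex A. *)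
Definition simplex_map (c a h : R) (z : R * R) : R * R :=
  (- c + 2 * c * z.1 + (a + c) * z.2, h * z.2).

Lemma continuous_lin2 (k1 k2 k0 : R) : continuous (fun z : R * R => k0 + k1 * z.1 + k2 * z.2).
Proof.
move=> z; apply: cvgD; first apply: cvgD; first exact: cvg_cst.
- by apply: cvgM; [exact: cvg_cst|exact: continuous_fst2].
- by apply: cvgM; [exact: cvg_cst|exact: continuous_snd2].
Qed.

Lemma continuous_simplex_map_comp (c a h : R) (f : R * R -> R) :
  continuous f -> continuous (f \o simplex_map c a h).
Proof.
move=> cf; apply: (continuous_comp_pair cf); first exact: continuous_lin2.
by move=> z; apply: cvgM; [exact: cvg_cst|exact: continuous_snd2].
Qed.

(** The map is triangular, so two one-dimensional changes of variables inside
    Tonelli's theorem are enough. *)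
Lemma ge0_integral_simplex_map (c a h : R) (F : R * R -> \bar R) : 0 < c -> 0 < h ->
  measurable_fun setT F -> (forall z, 0 <= F z)%E ->
  (\int[area]_z F z = (2 * c * h)%:E * \int[area]_z F (simplex_map c a h z))%E.
Proof.
move=> c0 h0 mF F0.
have maff : measurable_fun setT (simplex_map c a h).
  apply/measurable_fun_pairP; split.
    by apply: continuous_measurable2; exact: continuous_lin2.
  apply: continuous_measurable2.
  by move=> z; apply: cvgM; [exact: cvg_cst|exact: continuous_snd2].
have mFa : measurable_fun setT (F \o simplex_map c a h) by exact: measurableT_comp.
rewrite /area_measure fubini_tonelli2// [in RHS]fubini_tonelli2//; last first.
have mG : measurable_fun setT (fubini_G mu F) by exact: measurable_fun_fubini_tonelli_G.
have G0 y : (0 <= fubini_G mu F y)%E by exact: integral_ge0.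
rewrite (@ge0_integral_affine _ h 0)//; last by rewrite gt_eqF.
rewrite [LHS](_ : _ = (h%:E * \int[mu]_q ((2 * c)%:E * fubini_G mu (F \o simplex_map c a h) q))%E); last first.
  rewrite gtr0_norm//; congr (_ * _)%E; apply: eq_integral => q _.
  rewrite /fubini_G (@ge0_integral_affine _ (2 * c) (- c + (a + c) * q) (fun x => F (x, h * q + 0))); last 3 first.
  - by rewrite gt_eqF// mulr_gt0.
  - exact: measurableT_comp.
  - by [].
  rewrite gtr0_norm ?mulr_gt0//; congr (_ * _)%E; apply: eq_integral => p _.
  by rewrite /simplex_map/=; congr (F (_, _)); ring.
rewrite ge0_integralZl//; last 3 first.
- by apply: measurable_fun_fubini_tonelli_G => // z; exact: F0.
- by move=> q _; apply: integral_ge0 => z _; exact: F0.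
- by rewrite lee_fin mulr_ge0// ltW.
by rewrite muleA -EFinM; congr (_%:E * _)%E; ring.
Qed.

Lemma open_triangle_simplex_map (c a h : R) z : 0 < c -> 0 < h ->
  open_triangle (base_triangle c a h) (simplex_map c a h z) <-> simplex z.
Proof.
move=> c0 h0; split=> [[[[s1 s2] s3] /= [[p1 p2 p3] e ex ey]]|[p q r]].
  have e3 : s3 = z.2.
    apply: (@mulfI _ h); first by rewrite gt_eqF.
    by rewrite ey; ring.
  have e2 : s2 = z.1.
    apply: (@mulfI _ (2 * c)); first by rewrite gt_eqF// mulr_gt0.
    have e1 : s1 = 1 - s2 - s3 by lra.
    rewrite e1 e3 in ex *; lra.
  by rewrite /simplex/= -e3 -e2; split=> //; lra.
exists (1 - z.1 - z.2, z.1, z.2); split => /=.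
- by split => //; lra.
- ring.
- ring.
- ring.
Qed.

Definition simplex_map_inv (c a h : R) (x : R * R) : R * R :=
  ((x.1 + c - (a + c) * (x.2 / h)) / (2 * c), x.2 / h).

Lemma simplex_map_invK (c a h : R) x : 0 < c -> 0 < h -> simplex_map c a h (simplex_map_inv c a h x) = x.
Proof.
move=> c0 h0; case: x => x y; rewrite /simplex_map /simplex_map_inv/=; congr pair; field; rewrite ?gt_eqF//.
Qed.

Lemma measurable_open_triangle (c a h : R) : 0 < c -> 0 < h ->
  measurable (open_triangle (base_triangle c a h)).
Proof.
move=> c0 h0.
have -> : open_triangle (base_triangle c a h) = simplex_map_inv c a h @^-1` simplex.
  apply/seteqP; split=> x; have := @open_triangle_simplex_map c a h (simplex_map_inv c a h x) c0 h0;
    by rewrite simplex_map_invK//= => -[h1 h2].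
rewrite -[X in measurable X]setTI.
have : measurable_fun setT (simplex_map_inv c a h).
  apply/measurable_fun_pairP; split; apply: continuous_measurable2.
    rewrite (_ : _ \o _ = (fun z => 1/2 + (2 * c)^-1 * z.1 + (- ((a+c) / h) / (2 * c)) * z.2)); first exact: continuous_lin2.
    apply/funext => z; rewrite /simplex_map_inv/=; field.
    by rewrite (gt_eqF h0) (gt_eqF c0).
  by move=> z; apply: cvgM; [exact: continuous_snd2|exact: cvg_cst].
by apply; [exact: measurableT|exact: measurable_simplex].
Qed.

Lemma ge0_integral_triangle (c a h : R) (F : R * R -> \bar R) : 0 < c -> 0 < h ->
  measurable_fun setT F -> (forall z, 0 <= F z)%E ->
  (\int[area]_(x in open_triangle (base_triangle c a h)) F x =
   (2 * c * h)%:E * \int[area]_(z in simplex) F (simplex_map c a h z))%E.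
Proof.
move=> c0 h0 mF F0; rewrite integral_mkcond (ge0_integral_simplex_map (c:=c) a (h:=h)); last 4 first.
- by [].
- by [].
- apply/(measurable_restrictT _ _).1; first exact: measurable_open_triangle.
  exact: measurable_funTS.
- by move=> z; apply: erestrict_ge0.
rewrite [in RHS]integral_mkcond; congr (_ * _)%E; apply: eq_integral => z _.
rewrite !patchE; congr (if _ then _ else _); apply/idP/idP; rewrite !inE.
  by move/open_triangle_simplex_map; apply.
by move=> zs; apply/open_triangle_simplex_map.
Qed.

(** After this lemma the triangle enters an integral only through constants. *)
Lemma integral_triangle (c a h : R) (f : R * R -> R) : 0 < c -> 0 < h ->
  continuous f ->
  (\int[area]_(x in open_triangle (base_triangle c a h)) (f x)%:E = (2 * c * h * simplex_int (f \o simplex_map c a h))%:E)%E.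
Proof.
move=> c0 h0 cf; have cfa := continuous_simplex_map_comp (c:=c) (a:=a) (h:=h) cf.
have mf : measurable_fun setT (EFin \o f) by apply/measurable_EFinP; exact: continuous_measurable2.
have ifa := simplex_integrable cfa.
rewrite integralE !ge0_integral_triangle//; last 2 first.
- exact: measurable_funeneg.
- exact: measurable_funepos.
rewrite -muleBr//; last first.
  have H : area.-integrable simplex ((EFin \o f) \o simplex_map c a h) by exact: ifa.
  have := @integrable_add_def _ _ _ area simplex measurable_simplex _ H.
  by rewrite funepos_comp funeneg_comp.
rewrite [in RHS]EFinM -simplex_intE//; congr (_ * _)%E.
rewrite [RHS](_ : _ = \int[area]_(x in simplex) ((EFin \o f) \o simplex_map c a h) x)%E//.
by rewrite [in RHS]integralE (funepos_comp (EFin \o f) (simplex_map c a h)) (funeneg_comp (EFin \o f) (simplex_map c a h)).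
Qed.

End triangles.

(** * Continuously differentiable functions of two variables *)

Section C1_functions.
Context {R : realType}.
Implicit Types f g : R * R -> R.

Definition C1 f f1 f2 : Prop :=
  [/\ continuous f, continuous f1, continuous f2,
      forall z : R * R, is_derive z.1 1 (fun t => f (t, z.2)) (f1 z) &
      forall z : R * R, is_derive z.2 1 (fun t => f (z.1, t)) (f2 z)].

Lemma is_derive_mul (f g : R -> R) (x a b : R) :
  is_derive x 1 f a -> is_derive x 1 g b ->
  is_derive x 1 (fun t => f t * g t) (a * g x + f x * b).
Proof.
move=> df dg; have h : is_derive x 1 (fun t => f t * g t) (f x *: b + g x *: a) := is_deriveM df dg.
apply: (is_derive_eq h); rewrite /GRing.scale/=; ring.
Qed.

Lemma is_derive_add (f g : R -> R) (x a b : R) :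
  is_derive x 1 f a -> is_derive x 1 g b ->
  is_derive x 1 (fun t => f t + g t) (a + b).
Proof. by move=> df dg; have := is_deriveD df dg. Qed.

Lemma is_derive_lin (x k1 k0 : R) : is_derive x 1 (fun t => k1 * t + k0) k1.
Proof.
have h1 := is_derive_mul (is_derive_cst k1 x 1) (is_derive_id x 1).
apply: (is_derive_eq (is_derive_add h1 (is_derive_cst k0 x 1))).
by rewrite mul0r add0r mulr1 addr0.
Qed.

Lemma is_derive_cont (f : R -> R) (x a : R) : is_derive x 1 f a -> {for x, continuous f}.
Proof. by move=> [df _]; apply: differentiable_continuous; apply/derivable1_diffP. Qed.

(** No order between x and y is assumed: increments of both signs occur in a
    difference quotient. *)
Lemma mvt_abs (g dg : R -> R) (x y : R) : (forall t : R, is_derive t 1 g (dg t)) ->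
  exists2 z, `|z - x| <= `|y - x| & g y - g x = dg z * (y - x).
Proof.
move=> dgt; have cg (A : set R) : {within A, continuous g}.
  by apply: continuous_subspaceT => t; exact: is_derive_cont (dgt t).
have [xy|yx] := leP x y.
  have [c + h] := MVT_segment xy (fun t _ => dgt t) (cg _).
  rewrite in_itv/= => /andP[? ?]; exists c => //.
  by rewrite !ger0_norm ?subr_ge0// lerD2r.
have [c + h] := MVT_segment (ltW yx) (fun t _ => dgt t) (cg _).
rewrite in_itv/= => /andP[? ?]; exists c; last by rewrite -opprB h; ring.
by rewrite ler0_norm ?subr_le0// ler0_norm ?subr_le0 ?(ltW yx)// lerN2 lerD2r.
Qed.

(** The partial derivatives are continuous, so the increment along a slanted line
    can be split into a horizontal and a vertical one, each estimated by the mean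
    value theorem. Slanted lines are needed because the sides of a triangle are
    not parallel to the axes. *)
Lemma C1_chain f f1 f2 (x0 y0 e1 e2 t : R) : C1 f f1 f2 ->
  is_derive t 1 (fun t => f (x0 + e1 * t, y0 + e2 * t))
    (e1 * f1 (x0 + e1 * t, y0 + e2 * t) + e2 * f2 (x0 + e1 * t, y0 + e2 * t)).
Proof.
move=> [cf cf1 cf2 df1 df2].
set X := x0 + e1 * t; set Y := y0 + e2 * t; set F := fun _ => _.
set d := _ + _.
have H : h^-1 *: ((F \o shift t) (h *: (1:R)) - F t) @[h --> 0^'] --> d.
  apply/cvgrPdist_le => e e0.
  (* The summand 1 keeps K positive when the direction vanishes. *)
  pose K := `|e1| + `|e2| + 1.
  have K0 : 0 < K by rewrite /K ltr_wpDl// addr_ge0.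
  have eK : 0 < e / K by rewrite divr_gt0.
  have := cf1 (X, Y); move/cvgrPdist_le => /(_ _ eK) /nbhs_ballP[d1 /= d10 h1].
  have := cf2 (X, Y); move/cvgrPdist_le => /(_ _ eK) /nbhs_ballP[d2 /= d20 h2].
  have dK : 0 < Num.min d1 d2 / K by rewrite divr_gt0// lt_min d10.
  near=> h.
  have h0 : h != 0 by near: h; exact: nbhs_dnbhs_neq.
  have hd : `|h| * K < Num.min d1 d2.
    rewrite -ltr_pdivlMr//; near: h; apply: dnbhs0_lt; exact: dK.
  have [hd1 hd2] : `|h| * K < d1 /\ `|h| * K < d2.
    by move: hd; rewrite lt_min => /andP[].
  have ae1 : `|e1 * h| <= `|h| * K.
    by rewrite normrM mulrC ler_wpM2l// /K -addrA lerDl addr_ge0.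
  have ae2 : `|e2 * h| <= `|h| * K.
    by rewrite normrM mulrC ler_wpM2l// /K addrAC lerDr addr_ge0.
  have [z1 z1X e1q] := @mvt_abs (fun s => f (s, Y + e2 * h)) (fun s => f1 (s, Y + e2 * h))
    X (X + e1 * h) (fun s => df1 (s, Y + e2 * h)).
  have [z2 z2Y e2q] := @mvt_abs (fun s => f (X, s)) (fun s => f2 (X, s))
    Y (Y + e2 * h) (fun s => df2 (X, s)).
  have -> : h^-1 *: ((F \o shift t) (h *: (1 : R)) - F t) = e1 * f1 (z1, Y + e2 * h) + e2 * f2 (X, z2).
    rewrite /F /= /GRing.scale/= mulr1.
    have -> : x0 + e1 * (h + t) = X + e1 * h by rewrite /X; ring.
    have -> : y0 + e2 * (h + t) = Y + e2 * h by rewrite /Y; ring.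
    rewrite -/X -/Y.
    have -> : f (X + e1 * h, Y + e2 * h) - f (X, Y) =
       (f (X + e1 * h, Y + e2 * h) - f (X, Y + e2 * h)) + (f (X, Y + e2 * h) - f (X, Y)) by ring.
    by rewrite e1q e2q; field.
  have b1 : `|f1 (X, Y) - f1 (z1, Y + e2 * h)| <= e / K.
    apply: h1; split; rewrite /ball/= distrC.
      by apply: le_lt_trans z1X _; rewrite addrC addKr; apply: le_lt_trans hd1.
    by rewrite addrC addKr; apply: le_lt_trans hd1.
  have b2 : `|f2 (X, Y) - f2 (X, z2)| <= e / K.
    apply: h2; split; rewrite /ball/= distrC ?subrr ?normr0//.
    by apply: le_lt_trans z2Y _; rewrite addrC addKr; apply: le_lt_trans hd2.
  rewrite /d.
  have -> : e1 * f1 (X, Y) + e2 * f2 (X, Y) - (e1 * f1 (z1, Y + e2 * h) + e2 * f2 (X, z2)) =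
    e1 * (f1 (X, Y) - f1 (z1, Y + e2 * h)) + e2 * (f2 (X, Y) - f2 (X, z2)) by ring.
  apply: le_trans (ler_normD _ _) _; rewrite !normrM.
  apply: le_trans (lerD (ler_wpM2l (normr_ge0 e1) b1) (ler_wpM2l (normr_ge0 e2) b2)) _.
  by rewrite -mulrDl mulrCA ler_piMr ?(ltW e0)// ler_pdivrMr// mul1r /K lerDl.
apply: DeriveDef; first by apply/cvg_ex; exists d.
exact: cvg_lim H.
Unshelve. all: by end_near.
Qed.

Lemma C1_mul f f1 f2 g g1 g2 : C1 f f1 f2 -> C1 g g1 g2 ->
  C1 (fun z => f z * g z) (fun z => f1 z * g z + f z * g1 z) (fun z => f2 z * g z + f z * g2 z).
Proof.
move=> [cf cf1 cf2 df1 df2] [cg cg1 cg2 dg1 dg2]; split.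
- by move=> z; apply: cvgM; [exact: cf|exact: cg].
- by move=> z; apply: cvgD; apply: cvgM; [exact: cf1|exact: cg|exact: cf|exact: cg1].
- by move=> z; apply: cvgD; apply: cvgM; [exact: cf2|exact: cg|exact: cf|exact: cg2].
- by move=> [x y]; exact: is_derive_mul (df1 (x, y)) (dg1 (x, y)).
- by move=> [x y]; exact: is_derive_mul (df2 (x, y)) (dg2 (x, y)).
Qed.

Lemma C1_add f f1 f2 g g1 g2 : C1 f f1 f2 -> C1 g g1 g2 ->
  C1 (fun z => f z + g z) (fun z => f1 z + g1 z) (fun z => f2 z + g2 z).
Proof.
move=> [cf cf1 cf2 df1 df2] [cg cg1 cg2 dg1 dg2]; split.
- by move=> z; apply: cvgD; [exact: cf|exact: cg].
- by move=> z; apply: cvgD; [exact: cf1|exact: cg1].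
- by move=> z; apply: cvgD; [exact: cf2|exact: cg2].
- by move=> [x y]; exact: is_derive_add (df1 (x, y)) (dg1 (x, y)).
- by move=> [x y]; exact: is_derive_add (df2 (x, y)) (dg2 (x, y)).
Qed.

Lemma C1_cst (k : R) : C1 (fun=> k) (fun=> 0) (fun=> 0).
Proof. by split=> z; try exact: cvg_cst; exact: is_derive_cst. Qed.

Lemma C1_simplex_map (c a h : R) f f1 f2 : C1 f f1 f2 ->
  C1 (f \o simplex_map c a h) (fun z => 2 * c * f1 (simplex_map c a h z))
     (fun z => (a + c) * f1 (simplex_map c a h z) + h * f2 (simplex_map c a h z)).
Proof.
move=> Cf; have [cf cf1 cf2 _ _] := Cf.
have ca g : continuous g -> continuous (g \o simplex_map c a h) by exact: continuous_simplex_map_comp.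
split.
- exact: ca.
- by move=> z; apply: cvgM; [exact: cvg_cst|exact: (ca _ cf1)].
- by move=> z; apply: cvgD; apply: cvgM; try exact: cvg_cst; [exact: (ca _ cf1)|exact: (ca _ cf2)].
- move=> [p q] /=; have := @C1_chain _ _ _ (- c + (a + c) * q) (h * q) (2 * c) 0 p Cf.
  rewrite mul0r addr0.
  rewrite (_ : (fun t => f _) = (fun t => f (simplex_map c a h (t, q)))); last first.
    by apply/funext => t; rewrite /simplex_map/=; congr (f (_, _)); ring.
  move=> hd; apply: (is_derive_eq hd); rewrite /simplex_map/= mul0r addr0; congr (_ * f1 (_, _)); ring.
- move=> [p q] /=; have := @C1_chain _ _ _ (- c + 2 * c * p) 0 (a + c) h q Cf.
  rewrite (_ : (fun t => f _) = (fun t => f (simplex_map c a h (p, t)))); last first.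
    by apply/funext => t; rewrite /simplex_map/= add0r.
  by move=> hd; apply: (is_derive_eq hd); rewrite /simplex_map/= add0r.
Qed.

Lemma Ck_C1 k (f : R * R -> R) : Ck k.+1 f -> C1 f (partial1 f) (partial2 f).
Proof.
move=> /= [cf [d1 d2 C1f C2f]].
have cC (l : R * R -> R) : Ck k l -> continuous l by case: k {C1f C2f} => [|k] [].
split; [exact: cf|exact: cC|exact: cC| |] => z.
- by apply: DeriveDef; [exact: d1|rewrite /partial1 derive1E].
- by apply: DeriveDef; [exact: d2|rewrite /partial2 derive1E].
Qed.

Lemma smooth_C1 f : smooth f -> C1 f (partial1 f) (partial2 f).
Proof. by move=> sf; exact: Ck_C1 (sf 1%N). Qed.

Lemma C1_partial (f f1 f2 : R * R -> R) : C1 f f1 f2 -> partial1 f = f1 /\ partial2 f = f2.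
Proof.
move=> [_ _ _ d1 d2]; split; apply/funext => z; rewrite /partial1 /partial2 derive1E.
  by have h := d1 z; exact: derive_val.
by have h := d2 z; exact: derive_val.
Qed.

End C1_functions.

(** * Limits of squared norms *)

Section square_limits.
Context {R : realType}.

(** For nonnegative reals this is sqrt x <= sqrt y + sqrt d, since the infimum of
    the right-hand side over e is (sqrt y + sqrt d) ^ 2. In this form the
    inequality is linear in x, y, d and passes through integrals and sums. *)
Definition near_squares (x y d : \bar R) : Prop := forall e : R, 0 < e ->
  (x <= (1 + e)%:E * y + (1 + e^-1)%:E * d)%E.

(** This replaces the reverse triangle inequality for norms: X n tends to x when
    the square of the distance tends to 0. *)
Lemma near_squares_cvg (X D : nat -> \bar R) (x : \bar R) :
  (forall n, 0 <= X n < +oo)%E -> (0 <= x < +oo)%E -> (forall n, 0 <= D n)%E ->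
  (D n @[n --> \oo] --> (0 : \bar R))%E ->
  (forall n, near_squares (X n) x (D n)) ->
  (forall n, near_squares x (X n) (D n)) ->
  fine (X n) @[n --> \oo] --> fine x.
Proof.
move=> hX hx hD /fine_cvgP[fD cD] h1 h2.
apply/cvgrPdist_le => e e0.
set y := fine x.
have fin (z : \bar R) : (0 <= z < +oo)%E -> z = (fine z)%:E.
  by move=> /andP[z0 zy]; rewrite fineK// ge0_fin_numE.
have y0 : 0 <= y by rewrite fine_ge0//; case/andP: hx.
(* d plays the role of the free parameter in near_squares. *)
pose d := Num.min 1 (e / (4 * (y + e + 1))).
have d0 : 0 < d.
  by rewrite /d lt_min ltr01/= divr_gt0// mulr_gt0// -addrA ltr_wpDl// addr_gt0.
have de : d * (y + e + 1) <= e / 4.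
  have : d <= e / (4 * (y + e + 1)) by rewrite /d ge_min lexx orbT.
  rewrite ler_pdivlMr; last by rewrite mulr_gt0// -addrA ltr_wpDl// addr_gt0.
  move=> ?; lra.
have k0 : 0 < 1 + d^-1 by rewrite addr_gt0// invr_gt0.
have small : 0 < e / 4 / (1 + d^-1) by rewrite divr_gt0// divr_gt0.
move/cvgrPdist_le : cD => /(_ _ small) cD.
near=> n.
have fDn : D n \is a fin_num by near: n.
have : `|0 - fine (D n)| <= e / 4 / (1 + d^-1) by near: n.
rewrite sub0r normrN ger0_norm ?fine_ge0// ler_pdivlMr// => dn.
have := h1 n d d0; have := h2 n d d0.
rewrite (fin _ (hX n)) (fin _ hx) -(fineK fDn) -!EFinM -!EFinD !lee_fin -/y.
move: dn; set Dn := fine (D n); set Xn := fine (X n) => dn i2 i1.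
have Xn0 : 0 <= Xn by rewrite fine_ge0//; case/andP: (hX n).
have de0 := mulr_ge0 (ltW d0) (ltW e0).
have ub : Xn <= y + e / 2 by lra.
have : d * Xn <= e / 4.
  by apply: le_trans de; rewrite ler_pM2l//; lra.
by move=> dX; rewrite ler_norml /=; apply/andP; split; lra.
Unshelve. all: by end_near.
Qed.

Lemma near_squaresD (x y d x' y' d' : \bar R) :
  (0 <= y)%E -> (0 <= d)%E -> (0 <= y')%E -> (0 <= d')%E ->
  near_squares x y d -> near_squares x' y' d' -> near_squares (x + x')%E (y + y')%E (d + d')%E.
Proof.
move=> y0 d0 y'0 d'0 h h' e e0.
apply: (le_trans (leeD (h e e0) (h' e e0))).
by rewrite !ge0_muleDr// addeACA.
Qed.

Lemma near_squaresZ (l : R) (x y d : \bar R) : 0 <= l ->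
  (0 <= y)%E -> (0 <= d)%E ->
  near_squares x y d -> near_squares (l%:E * x)%E (l%:E * y)%E (l%:E * d)%E.
Proof.
move=> l0 y0 d0 h e e0.
apply: (@le_trans _ _ (l%:E * ((1 + e)%:E * y + (1 + e^-1)%:E * d))%E).
  by rewrite lee_wpmul2l ?lee_fin// h.
have e1 : 0 <= 1 + e by rewrite addr_ge0// ltW.
have e2 : 0 <= 1 + e^-1 by rewrite addr_ge0// invr_ge0 ltW.
by rewrite ge0_muleDr ?mule_ge0 ?lee_fin// !muleA [(l%:E * (1 + e)%:E)%E]muleC [(l%:E * (1 + e^-1)%:E)%E]muleC.
Qed.

Lemma near_squares_integral d (T : measurableType d) (mu : {measure set T -> \bar R})
  (D : set T) (f g : T -> R) : measurable D -> measurable_fun D f -> measurable_fun D g ->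
  near_squares (\int[mu]_(x in D) (f x ^+ 2)%:E)%E (\int[mu]_(x in D) (g x ^+ 2)%:E)%E
    (\int[mu]_(x in D) ((f \- g) x ^+ 2)%:E)%E.
Proof.
move=> mD mf mg e e0.
have e1 : 0 <= 1 + e by rewrite addr_ge0// ltW.
have e2 : 0 <= 1 + e^-1 by rewrite addr_ge0// invr_ge0 ltW.
have sq0 (h : T -> R) x : D x -> (0 <= (h x ^+ 2)%:E)%E by rewrite lee_fin sqr_ge0.
have msq (h : T -> R) : measurable_fun D h -> measurable_fun D (fun x => (h x ^+ 2)%:E).
  by move=> mh; apply/measurable_EFinP; exact: measurable_funX.
have mfg : measurable_fun D (f \- g) by exact: measurable_funB.
rewrite -ge0_integralZl_EFin//; [|exact: sq0|exact: msq].
rewrite -ge0_integralZl_EFin//; [|exact: sq0|exact: msq].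
rewrite -ge0_integralD//.
- apply: ge0_le_integral => //.
  + exact: sq0.
  + exact: msq.
  + by apply: emeasurable_funD; apply: measurable_funeM; apply: msq.
  + move=> x Dx; rewrite -!EFinM -EFinD lee_fin /=.
    set p := g x; set q := f x - g x; have -> : f x = p + q by rewrite /q /p; ring.
    (* The cross term 2 p q is absorbed by (e p - q) ^ 2 / e >= 0. *)
    have : 0 <= (e * p - q) ^+ 2 / e by rewrite divr_ge0 ?sqr_ge0// ltW.
    have -> : (e * p - q) ^+ 2 / e = e * p ^+ 2 - 2 * p * q + e^-1 * q ^+ 2 by field; lra.
    by move=> ?; nra.
- by move=> x Dx; rewrite mule_ge0 ?lee_fin// sqr_ge0.
- by apply: measurable_funeM; apply: msq.
- by move=> x Dx; rewrite mule_ge0 ?lee_fin// sqr_ge0.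
- by apply: measurable_funeM; apply: msq.
Qed.

Lemma near_squares_integralC d (T : measurableType d) (mu : {measure set T -> \bar R})
  (D : set T) (f g : T -> R) : measurable D -> measurable_fun D f -> measurable_fun D g ->
  near_squares (\int[mu]_(x in D) (g x ^+ 2)%:E)%E (\int[mu]_(x in D) (f x ^+ 2)%:E)%E
    (\int[mu]_(x in D) ((f \- g) x ^+ 2)%:E)%E.
Proof.
move=> mD mf mg; have := near_squares_integral mu mD mg mf.
by under [X in near_squares _ _ X]eq_integral do rewrite /= -sqrrN opprB.
Qed.

End square_limits.

(** * Smooth test functions *)

Section smooth_quotients.
Context {R : realType}.
Local Notation mu := (@lebesgue_measure R).
Local Notation area := (@area_measure R).
Implicit Types (T : triangle R) (phi : R * R -> R).

Definition side_mean (p q : R * R) phi : R := unit_int (fun t => phi (segment_point p q t) ^+ 2).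

Definition boundary_form T phi : R :=
  segment_length (vtxA T) (vtxB T) * side_mean (vtxA T) (vtxB T) phi
  + segment_length (vtxB T) (vtxC T) * side_mean (vtxB T) (vtxC T) phi
  + segment_length (vtxC T) (vtxA T) * side_mean (vtxC T) (vtxA T) phi.

Definition mass (c a h : R) phi : R := 2 * c * h * simplex_int (fun z => phi (simplex_map c a h z) ^+ 2).

(** The Dirichlet integral of phi on base_triangle c a h. *)
Definition energy (c a h : R) phi : R :=
  mass c a h (partial1 phi) + mass c a h (partial2 phi).

Lemma segment_length_ge0 (p q : R * R) : 0 <= segment_length p q.
Proof. exact: sqrtr_ge0. Qed.

Lemma continuous_sqr (T : topologicalType) (f : T -> R) : continuous f -> continuous (fun t => f t ^+ 2).
Proof. by move=> cf t; rewrite /continuous_at; under eq_fun do rewrite expr2; rewrite expr2; apply: cvgM; exact: cf. Qed.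

Lemma continuous_segment phi (p q : R * R) : continuous phi ->
  continuous (fun t => phi (segment_point p q t)).
Proof.
move=> cphi; apply: continuous_comp_pair => // t.
  by apply: cvgD; [exact: cvg_cst|apply: cvgM; [exact: cvg_id|exact: cvg_cst]].
by apply: cvgD; [exact: cvg_cst|apply: cvgM; [exact: cvg_id|exact: cvg_cst]].
Qed.

Lemma sqnorm_continuous (c a h : R) phi : 0 < c -> 0 < h -> continuous phi ->
  sqnorm (open_triangle (base_triangle c a h)) phi = (mass c a h phi)%:E.
Proof. by move=> c0 h0 cphi; rewrite /sqnorm integral_triangle//; exact: continuous_sqr. Qed.

Lemma side_sqnorm_continuous p q phi : continuous phi ->
  side_sqnorm p q phi = (segment_length p q * side_mean p q phi)%:E.
Proof.
move=> cphi; rewrite /side_sqnorm unit_intE; first by rewrite EFinM.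
by apply: continuous_sqr; exact: continuous_segment.
Qed.

Lemma boundary_sqnorm_continuous T phi : continuous phi ->
  boundary_sqnorm T phi = (boundary_form T phi)%:E.
Proof. by move=> cphi; rewrite /boundary_sqnorm !side_sqnorm_continuous// -!EFinD. Qed.

Lemma sqnorm_ge0 D phi : (0 <= sqnorm D phi)%E.
Proof. by apply: integral_ge0 => x _; rewrite lee_fin sqr_ge0. Qed.

Lemma side_sqnorm_ge0 (p q : R * R) phi : (0 <= side_sqnorm p q phi)%E.
Proof.
rewrite mule_ge0 ?lee_fin ?segment_length_ge0//.
by apply: integral_ge0 => x _; rewrite lee_fin sqr_ge0.
Qed.

Lemma boundary_sqnorm_ge0 T phi : (0 <= boundary_sqnorm T phi)%E.
Proof. by rewrite !adde_ge0 ?side_sqnorm_ge0. Qed.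

(** The support of psi stays inside the open triangle, so phi * psi vanishes on
    the three sides and the divergence theorem leaves no boundary term. *)
Lemma smooth_weak_gradient (c a h : R) phi : 0 < c -> 0 < h -> smooth phi ->
  weak_gradient (open_triangle (base_triangle c a h)) phi (partial1 phi) (partial2 phi).
Proof.
move=> c0 h0 /smooth_C1 Cphi psi [/smooth_C1 Cpsi [K [_ KT psi0]]].
have [cphi cphi1 cphi2 _ _] := Cphi; have [cpsi cpsi1 cpsi2 _ _] := Cpsi.
have Cw := C1_simplex_map c a h (C1_mul Cphi Cpsi).
have [cw cw1 cw2 dw1 dw2] := Cw.
have cM (f g : R * R -> R) : continuous f -> continuous g -> continuous (fun x => f x * g x).
  by move=> cf cg z; apply: cvgM; [exact: cf|exact: cg].
have out z : ~ simplex z -> psi (simplex_map c a h z) = 0.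
  move=> nz; apply: psi0 => /KT; rewrite open_triangle_simplex_map//.
have J1 := simplex_int_partial1 cw cw1 dw1; have J2 := simplex_int_partial2 cw cw2 dw2.
have E0 (k1 k2 : R -> R * R) : (forall t, ~ simplex (k1 t)) -> (forall t, ~ simplex (k2 t)) ->
   unit_int (fun t => ((fun z => phi z * psi z) \o simplex_map c a h) (k1 t) - ((fun z => phi z * psi z) \o simplex_map c a h) (k2 t)) = 0.
  move=> n1 n2; rewrite /unit_int /Rintegral integral0_eq// => t _ /=.
  by rewrite !out// !mulr0 subrr.
rewrite (E0 (fun t => (1 - t, t)) (fun t => (0, t))) in J1; last 2 first.
- by move=> t [/= _ _]; rewrite subrK ltxx.
- by move=> t [/=]; rewrite ltxx.
rewrite (E0 (fun t => (t, 1 - t)) (fun t => (t, 0))) in J2; last 2 first.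
- by move=> t [/= _ _]; rewrite addrC subrK ltxx.
- by move=> t [/= _]; rewrite ltxx.
pose j f := simplex_int (fun z => f (simplex_map c a h z)).
have jM (f g : R * R -> R) : continuous f -> continuous g ->
    continuous (fun z => f (simplex_map c a h z) * g (simplex_map c a h z)).
  by move=> cf cg; exact: (continuous_simplex_map_comp (cM _ _ cf cg)).
have jD (f1 g1 f2 g2 : R * R -> R) : continuous f1 -> continuous g1 -> continuous f2 -> continuous g2 ->
    simplex_int (fun z => f1 (simplex_map c a h z) * g1 (simplex_map c a h z) + f2 (simplex_map c a h z) * g2 (simplex_map c a h z))
    = j (fun x => f1 x * g1 x) + j (fun x => f2 x * g2 x).
  move=> *; rewrite -[X in X + _]mul1r -[X in _ + X]mul1r -simplex_int_linear; [|exact: jM|exact: jM].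
  by congr simplex_int; apply/funext => z; rewrite !mul1r.
have cW (f1 g1 f2 g2 : R * R -> R) : continuous f1 -> continuous g1 -> continuous f2 -> continuous g2 ->
    continuous (fun z => f1 (simplex_map c a h z) * g1 (simplex_map c a h z) + f2 (simplex_map c a h z) * g2 (simplex_map c a h z)).
  by move=> h1 h2 h3 h4 z; apply: cvgD; [exact: (jM _ _ h1 h2)|exact: (jM _ _ h3 h4)].
set W1 := fun z => partial1 phi (simplex_map c a h z) * psi (simplex_map c a h z) + phi (simplex_map c a h z) * partial1 psi (simplex_map c a h z).
set W2 := fun z => partial2 phi (simplex_map c a h z) * psi (simplex_map c a h z) + phi (simplex_map c a h z) * partial2 psi (simplex_map c a h z).
have cW1 : continuous W1 by exact: cW.
have cW2 : continuous W2 by exact: cW.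
have j1 : simplex_int W1 = 0.
  apply: (@mulfI _ (2 * c)); first by rewrite gt_eqF// mulr_gt0.
  by rewrite mulr0 -J1; apply: esym; exact: (simplex_intZ (2 * c) cW1).
have j2 : simplex_int W2 = 0.
  apply: (@mulfI _ h); first by rewrite gt_eqF.
  have e := simplex_int_linear (a + c) h cW1 cW2; rewrite j1 mulr0 add0r in e.
  by rewrite mulr0 -J2 -e; congr simplex_int; apply/funext => z; rewrite /W1 /W2; ring.
rewrite jD// in j1; rewrite jD// in j2.
have {}j1 : j (fun x => phi x * partial1 psi x) = - j (fun x => partial1 phi x * psi x).
  by apply/eqP; rewrite -addr_eq0 addrC j1.
have {}j2 : j (fun x => phi x * partial2 psi x) = - j (fun x => partial2 phi x * psi x).
  by apply/eqP; rewrite -addr_eq0 addrC j2.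
split; rewrite !integral_triangle//; try exact: cM; rewrite -EFinN; congr EFin.
  by rewrite -[LHS]/(2 * c * h * j (fun x => phi x * partial1 psi x)) j1 mulrN.
by rewrite -[LHS]/(2 * c * h * j (fun x => phi x * partial2 psi x)) j2 mulrN.
Qed.

(** A smooth function is its own trace, with a constant approximating sequence. *)
Lemma lambda1_le_smooth (alpha c a h : R) phi : 0 < c -> 0 < h -> smooth phi -> 0 < mass c a h phi ->
  (lambda1 alpha (base_triangle c a h) <=
    ((energy c a h phi + alpha * boundary_form (base_triangle c a h) phi) / mass c a h phi)%:E)%E.
Proof.
move=> c0 h0 sphi M0; set T := base_triangle c a h.
have [cphi cphi1 cphi2 _ _] := smooth_C1 sphi.
have mT : measurable (open_triangle T) by exact: measurable_open_triangle.
have inL2 f : continuous f -> in_L2 (open_triangle T) f.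
  by move=> cf; split; [exact: continuous_measurable2|rewrite sqnorm_continuous// ltry].
apply: ereal_inf_lbound; exists phi, (partial1 phi), (partial2 phi), phi; split.
- by split; [exact: inL2|exact: inL2|exact: inL2|exact: smooth_weak_gradient].
- move=> ae0; have : sqnorm (open_triangle T) phi = 0%E.
    rewrite /sqnorm (ae_eq_integral (cst 0%E))//; first by rewrite integral0.
    + by apply/measurable_EFinP; apply: continuous_measurable2; exact: continuous_sqr.
    + move: ae0; apply: filterS => x h1 Dx; rewrite h1//= expr0n//.
  by rewrite sqnorm_continuous// => -[M0']; rewrite M0' ltxx in M0.
- have z0 D f : sqnorm D (f \- f) = 0%E.
    by rewrite /sqnorm integral0_eq// => x _ /=; rewrite subrr expr0n.
  have b0 f : boundary_sqnorm T (f \- f) = 0%E.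
    by rewrite /boundary_sqnorm /side_sqnorm !integral0_eq ?mule0 ?adde0// => x _ /=; rewrite subrr expr0n.
  split.
    split; try by apply: measurable_funTS; apply: continuous_measurable_fun; exact: continuous_segment.
    by rewrite boundary_sqnorm_continuous// ltry.
  exists (fun=> phi); split => //.
  + by rewrite z0; exact: cvg_cst.
  + by rewrite z0; exact: cvg_cst.
  + by rewrite z0; exact: cvg_cst.
  + by rewrite b0; exact: cvg_cst.
- by rewrite /rayleigh_quotient !sqnorm_continuous// boundary_sqnorm_continuous.
Qed.

End smooth_quotients.

(** * Near-minimisers can be taken smooth *)

Section near_minimisers.
Context {R : realType}.
Local Notation mu := (@lebesgue_measure R).
Local Notation area := (@area_measure R).

(** An admissible function comes with smooth functions that converge to it in H1
    and, on the boundary, to its trace. Along them every integral in the quotient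
    converges, so a strict upper bound survives for one of them. *)
Lemma smooth_below (alpha m c a h : R) : 0 < c -> 0 < h ->
  (lambda1 alpha (base_triangle c a h) < m%:E)%E ->
  exists phi, [/\ smooth phi, 0 < mass c a h phi &
    energy c a h phi + alpha * boundary_form (base_triangle c a h) phi < m * mass c a h phi].
Proof.
move=> c0 h0 /ereal_inf_lt[_ [u [v1 [v2 [g [H1 une [[mg1 mg2 mg3 gfin] [phi [sphi cu cv1 cv2 cg]]] ->]]]]]].
rewrite lte_fin /rayleigh_quotient.
set T := base_triangle c a h in gfin cu cv1 cv2 cg *; set D := open_triangle T in cu cv1 cv2 *.
case: H1 => -[mu_ ufin] [mv1 v1fin] [mv2 v2fin] _.
have mD : measurable D by exact: measurable_open_triangle.
have C n := smooth_C1 (sphi n).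
have lim_sq (f : R * R -> R) (F : nat -> R * R -> R) : measurable_fun D f -> (sqnorm D f < +oo)%E ->
    (forall n, continuous (F n)) -> sqnorm D (F n \- f) @[n --> \oo] --> (0 : \bar R)%E ->
    mass c a h (F n) @[n --> \oo] --> fine (sqnorm D f).
  move=> mf ffin cF cvF.
  under eq_fun do rewrite -[mass c a h _]/(fine (mass c a h _)%:E) -sqnorm_continuous//.
  apply: near_squares_cvg cvF _ _ => //.
  - by move=> n; rewrite sqnorm_ge0 sqnorm_continuous// ltry.
  - by rewrite sqnorm_ge0.
  - by move=> n; exact: sqnorm_ge0.
  - by move=> n; apply: near_squares_integral => //; exact: continuous_measurable2.
  - by move=> n; apply: near_squares_integralC => //; exact: continuous_measurable2.
have lu : mass c a h (phi n) @[n --> \oo] --> fine (sqnorm D u).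
  by apply: lim_sq => // n; case: (C n).
have lv1 : mass c a h (partial1 (phi n)) @[n --> \oo] --> fine (sqnorm D v1).
  by apply: lim_sq => // n; case: (C n).
have lv2 : mass c a h (partial2 (phi n)) @[n --> \oo] --> fine (sqnorm D v2).
  by apply: lim_sq => // n; case: (C n).
have lg : boundary_form T (phi n) @[n --> \oo] --> fine (boundary_sqnorm T g).
  have cphi n : continuous (phi n) by case: (C n).
  under eq_fun do rewrite -[boundary_form _ _]/(fine (boundary_form _ _)%:E) -boundary_sqnorm_continuous//.
  have I0 (k : R -> R) : (0 <= \int[mu]_(t in unit_interval) (k t ^+ 2)%:E)%E.
    by apply: integral_ge0 => x _; rewrite lee_fin sqr_ge0.
  have mseg n p q : measurable_fun unit_interval (phi n \o segment_point p q).
    by apply: measurable_funTS; apply: continuous_measurable_fun; exact: continuous_segment.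
  have munit : measurable (@unit_interval R) by exact: measurable_itv.
  apply: near_squares_cvg cg _ _ => //.
  - by move=> n; rewrite boundary_sqnorm_ge0 boundary_sqnorm_continuous// ltry.
  - by rewrite boundary_sqnorm_ge0.
  - by move=> n; exact: boundary_sqnorm_ge0.
  - move=> n; apply: near_squaresD; rewrite ?adde_ge0 ?side_sqnorm_ge0//.
      apply: near_squaresD; rewrite ?side_sqnorm_ge0//; apply: near_squaresZ => //; rewrite ?segment_length_ge0//.
        exact: (near_squares_integral mu munit (mseg n _ _) mg1).
      exact: (near_squares_integral mu munit (mseg n _ _) mg2).
    apply: near_squaresZ => //; rewrite ?segment_length_ge0//.
    exact: (near_squares_integral mu munit (mseg n _ _) mg3).
  - move=> n; apply: near_squaresD; rewrite ?adde_ge0 ?side_sqnorm_ge0//.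
      apply: near_squaresD; rewrite ?side_sqnorm_ge0//; apply: near_squaresZ => //; rewrite ?segment_length_ge0//.
        exact: (near_squares_integralC mu munit (mseg n _ _) mg1).
      exact: (near_squares_integralC mu munit (mseg n _ _) mg2).
    apply: near_squaresZ => //; rewrite ?segment_length_ge0//.
    exact: (near_squares_integralC mu munit (mseg n _ _) mg3).
have u0 : 0 < fine (sqnorm D u).
  rewrite lt0r fine_ge0 ?sqnorm_ge0// andbT; apply/eqP => u0; apply: une.
  have usq : sqnorm D u = 0%E.
    by rewrite -(fineK (x := sqnorm D u)) ?u0// ge0_fin_numE ?sqnorm_ge0.
  have msq : measurable_fun D (fun x => (u x ^+ 2)%:E).
    by apply/measurable_EFinP; exact: measurable_funX.
  have : ae_eq area D (fun x => (u x ^+ 2)%:E) (cst 0%E).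
    apply/(ae_eq_integral_abs area mD msq).
    rewrite -usq; apply: eq_integral => x _.
    by rewrite gee0_abs// lee_fin sqr_ge0.
  apply: filterS => x h1 Dx; have := h1 Dx => /= -[] /eqP.
  by rewrite sqrf_eq0 => /eqP.
rewrite ltr_pdivrMr// fineD ?ge0_fin_numE ?sqnorm_ge0//.
set A := fine _; set B := fine _; set G := fine _; set U := fine _ => hlt.
have lim : energy c a h (phi n) + alpha * boundary_form T (phi n) - m * mass c a h (phi n)
    @[n --> \oo] --> A + B + alpha * G - m * U.
  apply: cvgB; last by apply: cvgM; [exact: cvg_cst|exact: lu].
  by apply: cvgD; [apply: cvgD; [exact: lv1|exact: lv2]|apply: cvgM; [exact: cvg_cst|exact: lg]].
have neg : A + B + alpha * G - m * U < 0 by rewrite subr_lt0.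
have n1 : \forall n \near \oo, energy c a h (phi n) + alpha * boundary_form T (phi n) - m * mass c a h (phi n) < 0.
  exact: (cvgr_lt _ lim).
have n2 : \forall n \near \oo, 0 < mass c a h (phi n).
  exact: (cvgr_gt _ lu).
have [n [hn1 hn2]] := @filter_ex _ \oo _ _ (filterI n1 n2).
by exists (phi n); split => //; rewrite -subr_lt0.
Qed.

End near_minimisers.

(** * Hyperbolic functions and the Robin parameter *)

Section hyperbolic.
Context {R : realType}.
Implicit Types (x y rho : R).

(** Twice the hyperbolic sine; with dcosh, twice the cosine, the sum-to-product
    formulas have no factor 1/2. *)
Definition dsinh x : R := expR x - expR (- x).
Definition dcosh x : R := expR x + expR (- x).

Lemma dcosh_gt0 x : 0 < dcosh x. Proof. by rewrite addr_gt0 ?expR_gt0. Qed.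

Lemma dsinh_le x : `|dsinh x| <= dcosh x.
Proof.
have h1 := expR_gt0 x; have h2 := expR_gt0 (- x).
rewrite ler_norml /dsinh /dcosh; apply/andP; split; lra.
Qed.

Lemma dsinhD x y : dsinh x + dsinh y = dsinh ((x + y) / 2) * dcosh ((x - y) / 2).
Proof.
have H s d : dsinh (s + d) + dsinh (s - d) = dsinh s * dcosh d.
  by rewrite /dsinh /dcosh !opprD opprK !expRD; ring.
by rewrite -H; congr (dsinh _ + dsinh _); field.
Qed.

Lemma dcoshD x y : dcosh x + dcosh y = dcosh ((x + y) / 2) * dcosh ((x - y) / 2).
Proof.
have H s d : dcosh (s + d) + dcosh (s - d) = dcosh s * dcosh d.
  by rewrite /dcosh !opprD opprK !expRD; ring.
by rewrite -H; congr (dcosh _ + dcosh _); field.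
Qed.

Lemma dsinhN x : dsinh (- x) = - dsinh x.
Proof. by rewrite /dsinh opprK; ring. Qed.

Lemma dcoshN x : dcosh (- x) = dcosh x.
Proof. by rewrite /dcosh opprK addrC. Qed.

Definition artanh rho : R := ln ((1 + rho) / (1 - rho)) / 2.

Lemma artanhP rho : 0 <= rho -> rho < 1 -> dsinh (artanh rho) = rho * dcosh (artanh rho).
Proof.
move=> r0 r1; set y := artanh rho.
have q0 : 0 < (1 + rho) / (1 - rho) by rewrite divr_gt0 ?subr_gt0// ltr_pwDl.
have e2 : expR y * expR y = (1 + rho) / (1 - rho).
  by rewrite -expRD -mulr2n -mulr_natr /y /artanh divfK// lnK.
have ey := expR_gt0 y.
rewrite /dsinh /dcosh expRN; apply: (@mulfI _ (expR y)); first by rewrite gt_eqF.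
rewrite mulrBr mulrCA mulrDr divff ?gt_eqF// e2; field; lra.
Qed.

Lemma artanh_ge0 rho : 0 <= rho -> rho < 1 -> 0 <= artanh rho.
Proof.
move=> r0 r1; rewrite divr_ge0// ln_ge0// ler_pdivlMr ?subr_gt0//; lra.
Qed.

Lemma artanh_gt0 rho : 0 < rho -> rho < 1 -> 0 < artanh rho.
Proof.
move=> r0 r1; rewrite divr_gt0// ln_gt0// ltr_pdivlMr ?subr_gt0//; lra.
Qed.

Lemma artanh_le x y : 0 <= x -> x <= y -> y < 1 -> artanh x <= artanh y.
Proof.
move=> x0 xy y1; have hx : 0 < 1 - x by lra.
have hy : 0 < 1 - y by lra.
have px : 0 < 1 + x by lra.
have py : 0 < 1 + y by lra.
rewrite /artanh ler_pM2r// ler_ln ?posrE ?divr_gt0//.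
by rewrite ler_pdivrMr// mulrAC ler_pdivlMr//; lra.
Qed.

(** Let r be the inradius of an equilateral triangle whose lowest eigenvalue is
    - k ^ 2 for the boundary parameter - s, and put rho = s / k. Then
    k * r = wavenumber rho, and s * r = robin_param rho. *)
Definition wavenumber rho : R := 2 / 3 * (artanh rho + artanh (2 * rho)).
Definition robin_param rho : R := wavenumber rho * rho.

Lemma wavenumber_gt0 rho : 0 < rho -> rho < 1 / 2 -> 0 < wavenumber rho.
Proof.
move=> r0 r1; have h1 := @artanh_gt0 rho r0 ltac:(lra).
have h2 := @artanh_gt0 (2 * rho) ltac:(lra) ltac:(lra); rewrite /wavenumber; lra.
Qed.

Lemma wavenumber_le x y : 0 < x -> x <= y -> y < 1 / 2 -> wavenumber x <= wavenumber y.
Proof.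
move=> x0 xy y1; have h1 := @artanh_le x y ltac:(lra) ltac:(lra) ltac:(lra).
have h2 := @artanh_le (2 * x) (2 * y) ltac:(lra) ltac:(lra) ltac:(lra); rewrite /wavenumber; lra.
Qed.

(** So rho increases with s, and s ^ 2 / rho ^ 2, the absolute value of the
    eigenvalue, grows more slowly than s ^ 2. The comparison of two boundary
    parameters rests on this. *)
Lemma robin_param_lt_inv x y : 0 < x -> x < 1 / 2 -> 0 < y -> robin_param x < robin_param y -> x < y.
Proof.
move=> x0 x1 y0; apply: contraTT; rewrite -!leNgt => yx.
have := @wavenumber_le y x y0 yx x1; have := @wavenumber_gt0 x x0 x1 => d0 d1.
by rewrite /robin_param ler_pM// ?ltW// wavenumber_gt0//; lra.
Qed.

Lemma artanh_continuous rho : 0 <= rho < 1 -> {for rho, continuous artanh}.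
Proof.
move=> /andP[r0 r1]; apply: cvgM; last exact: cvg_cst.
apply: (@continuous_comp _ _ _ (fun r : R => (1 + r) / (1 - r)) (@ln R)).
  apply: cvgM; first by apply: cvgD; [exact: cvg_cst|exact: cvg_id].
  apply: cvgV; first by rewrite gt_eqF// subr_gt0.
  by apply: cvgB; [exact: cvg_cst|exact: cvg_id].
by apply: continuous_ln; rewrite divr_gt0 ?subr_gt0// ltr_pwDl.
Qed.

(** Intermediate values: robin_param vanishes at 0 and its logarithm blows up
    at 1 / 2. *)
Lemma robin_param_onto (s : R) : 0 < s -> exists rho, [/\ 0 < rho, rho < 1 / 2 & robin_param rho = s].
Proof.
(* With this b, artanh (2 * b) >= 6 * s while b >= 1 / 4, hence
   robin_param b >= (2 / 3) * (6 * s) * (1 / 4) = s. *)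
move=> s0; pose b := (1 - expR (- 12 * s) / 2) / 2.
have e0 := expR_gt0 (- 12 * s).
have e1 : expR (- 12 * s) < 1 by rewrite -[ltRHS]expR0 ltr_expR; lra.
have b1 : 1 / 4 < b by rewrite /b; lra.
have b2 : b < 1 / 2 by rewrite /b; lra.
have sb : s <= robin_param b.
  have ab : 6 * s <= artanh (2 * b).
    rewrite /artanh ler_pdivlMr// -(expRK (6 * s * 2)) ler_ln ?posrE ?expR_gt0//; last first.
      by rewrite divr_gt0//; lra.
    rewrite ler_pdivlMr; last by lra.
    have -> : 1 - 2 * b = expR (- 12 * s) / 2 by rewrite /b; field.
    rewrite mulrA -expRD (_ : 6 * s * 2 + _ = 0) ?expR0; last by ring.
    lra.
  have a0 : 0 <= artanh b by apply: artanh_ge0; lra.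
  rewrite /robin_param /wavenumber; nra.
have cr : {within `[0, b], continuous robin_param}.
  apply: continuous_in_subspaceT => x; rewrite inE/= in_itv/= => /andP[x0 xb].
  apply: cvgM; last exact: cvg_id.
  apply: cvgM; first exact: cvg_cst.
  apply: cvgD; first by apply: artanh_continuous; apply/andP; split; lra.
  apply: (@continuous_comp _ _ _ (fun r : R => 2 * r) artanh).
    by apply: cvgM; [exact: cvg_cst|exact: cvg_id].
  by apply: artanh_continuous; apply/andP; split; lra.
have r0 : robin_param 0 = 0 by rewrite /robin_param mulr0.
have [|rho] := @IVT R robin_param 0 b s ltac:(lra) cr.
  by rewrite r0 ge_min le_max (ltW s0) sb orbT.
rewrite in_itv/= => /andP[h0 h1] hs; exists rho; split=> //; last lra.
rewrite lt0r h0 andbT; apply/eqP => z; rewrite z r0 in hs; lra.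
Qed.

End hyperbolic.

(** * The ground state in barycentric coordinates *)

Section ground_state.
Context {R : realType}.
Implicit Types f g : R * R -> R.

Lemma C1_ext f f1 f2 g g1 g2 : C1 f f1 f2 -> f =1 g -> f1 =1 g1 -> f2 =1 g2 -> C1 g g1 g2.
Proof. by move=> + /funext <- /funext <- /funext <-. Qed.

Lemma C1_comp (F dF : R -> R) f f1 f2 : continuous dF -> (forall x : R, is_derive x 1 F (dF x)) ->
  C1 f f1 f2 -> C1 (fun z => F (f z)) (fun z => dF (f z) * f1 z) (fun z => dF (f z) * f2 z).
Proof.
move=> cdF hF [cf cf1 cf2 df1 df2].
have cF : continuous F by move=> x; exact: is_derive_cont (hF x).
split.
- by move=> z; apply: continuous_comp; [exact: cf|exact: cF].
- by move=> z; apply: cvgM; [apply: (continuous_comp (cf z)); exact: cdF|exact: cf1].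
- by move=> z; apply: cvgM; [apply: (continuous_comp (cf z)); exact: cdF|exact: cf2].
- by move=> [x y]; exact: (@is_derive1_comp _ F (fun t => f (t, y)) x _ _ (hF _) (df1 (x, y))).
- by move=> [x y]; exact: (@is_derive1_comp _ F (fun t => f (x, t)) y _ _ (hF _) (df2 (x, y))).
Qed.

Lemma C1_inv f f1 f2 : (forall z, 0 < f z) -> C1 f f1 f2 ->
  C1 (fun z => (f z)^-1) (fun z => - f1 z / f z ^+ 2) (fun z => - f2 z / f z ^+ 2).
Proof.
move=> f0 [cf cf1 cf2 df1 df2].
have fn0 z : f z != 0 by rewrite gt_eqF.
have c2 : continuous (fun z => f z ^+ 2) by exact: continuous_sqr.
have n2 z : f z ^+ 2 != 0 by rewrite expf_neq0.
split.
- by move=> z; apply: cvgV; [exact: fn0|exact: cf].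
- by move=> z; apply: cvgM; [apply: cvgN; exact: cf1|apply: cvgV; [exact: n2|exact: c2]].
- by move=> z; apply: cvgM; [apply: cvgN; exact: cf2|apply: cvgV; [exact: n2|exact: c2]].
- move=> [x y]; apply: (is_derive_eq (@is_deriveV _ (fun t => f (t, y)) x _ 1 (fn0 _) (df1 (x, y)))).
  by rewrite /GRing.scale/= mulNr mulrC mulNr.
- move=> [x y]; apply: (is_derive_eq (@is_deriveV _ (fun t => f (x, t)) y _ 1 (fn0 _) (df2 (x, y)))).
  by rewrite /GRing.scale/= mulNr mulrC mulNr.
Qed.

Lemma C1_lin (k0 k1 k2 : R) : C1 (fun z => k0 + k1 * z.1 + k2 * z.2) (fun=> k1) (fun=> k2).
Proof.
split; try by move=> z; exact: cvg_cst.
- exact: continuous_lin2.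
- move=> [x y] /=; have := is_derive_lin x k1 (k0 + k2 * y).
  by rewrite (_ : (fun t => _) = (fun t => k0 + k1 * t + k2 * y))//; apply/funext => t; ring.
- move=> [x y] /=; have := is_derive_lin y k2 (k0 + k1 * x).
  by rewrite (_ : (fun t => _) = (fun t => k0 + k1 * x + k2 * t))//; apply/funext => t; ring.
Qed.

Lemma continuous_expRN : continuous (fun x : R => expR (- x)).
Proof.
move=> x; apply: (@continuous_comp _ _ _ -%R (@expR R)); last exact: continuous_expR.
by apply: cvgN; exact: cvg_id.
Qed.

Lemma is_derive_expRN (x : R) : is_derive x 1 (fun x : R => expR (- x)) (- expR (- x)).
Proof.
have h := @is_derive1_comp _ (@expR R) -%R x _ _ (is_derive_expR _) (is_deriveNid x 1).
by apply: (is_derive_eq h); rewrite mulrN1.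
Qed.

Lemma C1_dcosh f f1 f2 : C1 f f1 f2 ->
  C1 (fun z => dcosh (f z)) (fun z => dsinh (f z) * f1 z) (fun z => dsinh (f z) * f2 z).
Proof.
apply: C1_comp => x.
  by apply: cvgB; [exact: continuous_expR|exact: continuous_expRN].
exact: (is_derive_add (is_derive_expR x) (is_derive_expRN x)).
Qed.

Lemma C1_dsinh f f1 f2 : C1 f f1 f2 ->
  C1 (fun z => dsinh (f z)) (fun z => dcosh (f z) * f1 z) (fun z => dcosh (f z) * f2 z).
Proof.
apply: C1_comp => x.
  by apply: cvgD; [exact: continuous_expR|exact: continuous_expRN].
have := is_derive_add (is_derive_expR x) (is_derive_mul (is_derive_cst (-1 : R) x 1) (is_derive_expRN x)).
rewrite (_ : (fun t => _) = dsinh); last by apply/funext => t; rewrite /dsinh mulN1r.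
by move=> h; apply: (is_derive_eq h); rewrite mul0r add0r mulN1r opprK.
Qed.

Variables kap q : R.

(** Let r be the inradius and kap = k * r. At barycentric coordinates b_i, the
    point lies at signed distance r * (1 - 3 * b_i) from the centre in the
    direction of side i, and the phase of side i is k times this distance,
    minus q. The sum of the three hyperbolic cosines solves Delta u = k ^ 2 u
    and, for a suitable q, satisfies the Robin condition on all three sides. *)
Definition phaseA (z : R * R) : R := - (2 * kap) - q + 3 * kap * z.1 + 3 * kap * z.2.
Definition phaseB (z : R * R) : R := kap - q + (- (3 * kap)) * z.1 + 0 * z.2.
Definition phaseC (z : R * R) : R := kap - q + 0 * z.1 + (- (3 * kap)) * z.2.
Definition ground_ref (z : R * R) : R := dcosh (phaseA z) + dcosh (phaseB z) + dcosh (phaseC z).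
Definition ground_ref1 (z : R * R) : R := 3 * kap * (dsinh (phaseA z) - dsinh (phaseB z)).
Definition ground_ref2 (z : R * R) : R := 3 * kap * (dsinh (phaseA z) - dsinh (phaseC z)).
(** (flow1, flow2) are the components along B - A and C - A of
    r ^ 2 * grad (ln u), where u is the ground state. They depend on kap and q
    only, not on the size of the triangle. *)
Definition flow1 (z : R * R) : R := kap / 6 * (dsinh (phaseA z) - 2 * dsinh (phaseB z) + dsinh (phaseC z)) / ground_ref z.
Definition flow2 (z : R * R) : R := kap / 6 * (dsinh (phaseA z) + dsinh (phaseB z) - 2 * dsinh (phaseC z)) / ground_ref z.

Lemma ground_ref_gt0 z : 0 < ground_ref z.
Proof. by apply: addr_gt0; first apply: addr_gt0; exact: dcosh_gt0. Qed.

Lemma C1_ground_ref : C1 ground_ref ground_ref1 ground_ref2.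
Proof.
have CA := C1_dcosh (C1_lin (- (2 * kap) - q) (3 * kap) (3 * kap)).
have CB := C1_dcosh (C1_lin (kap - q) (- (3 * kap)) 0).
have CC := C1_dcosh (C1_lin (kap - q) 0 (- (3 * kap))).
apply: (C1_ext (C1_add (C1_add CA CB) CC)) => z.
- by [].
- by rewrite /ground_ref1 /phaseA /phaseB; ring.
- by rewrite /ground_ref2 /phaseA /phaseC; ring.
Qed.

(** For an eigenfunction u the field X = grad u / u satisfies
    div X = k ^ 2 - |X| ^ 2. The quadratic form on the right is r ^ 2 |X| ^ 2 for
    the metric of the equilateral triangle. *)
Lemma flow_divergence : exists Y11 Y12 Y21 Y22,
  [/\ C1 flow1 Y11 Y12, C1 flow2 Y21 Y22 &
   forall z, Y11 z + Y22 z = kap ^+ 2 - 12 * (flow1 z ^+ 2 + flow1 z * flow2 z + flow2 z ^+ 2)].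
Proof.
have CA := C1_dsinh (C1_lin (- (2 * kap) - q) (3 * kap) (3 * kap)).
have CB := C1_dsinh (C1_lin (kap - q) (- (3 * kap)) 0).
have CC := C1_dsinh (C1_lin (kap - q) 0 (- (3 * kap))).
have CU := C1_inv ground_ref_gt0 C1_ground_ref.
have CN1 := C1_mul (C1_cst (kap / 6)) (C1_add (C1_add CA (C1_mul (C1_cst (-2)) CB)) CC).
have CN2 := C1_mul (C1_cst (kap / 6)) (C1_add (C1_add CA CB) (C1_mul (C1_cst (-2)) CC)).
have CY1 := C1_mul CN1 CU; have CY2 := C1_mul CN2 CU.
do 4 eexists; split.
- apply: (C1_ext CY1); [|by move=> z; reflexivity|by move=> z; reflexivity] => z.
  by rewrite /flow1 /phaseA /phaseB /phaseC; congr (_ / _); ring.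
- apply: (C1_ext CY2); [|by move=> z; reflexivity|by move=> z; reflexivity] => z.
  by rewrite /flow2 /phaseA /phaseB /phaseC; congr (_ / _); ring.
- move=> z /=; rewrite -/(phaseA z) -/(phaseB z) -/(phaseC z) /ground_ref1 /ground_ref2 /flow1 /flow2.
  have := ground_ref_gt0 z; rewrite /ground_ref.
  move: (dsinh (phaseA z)) (dsinh (phaseB z)) (dsinh (phaseC z)) (dcosh (phaseA z)) (dcosh (phaseB z)) (dcosh (phaseC z)) => a b c a' b' c' u0.
  field; lra.
Qed.

(** Each hyperbolic sine is at most the corresponding cosine, and the coefficients
    1, -2, 1 are at most 2. *)
Lemma flow_bound z : 0 <= kap -> `|flow1 z| <= kap / 3 /\ `|flow2 z| <= kap / 3.
Proof.
move=> k0; have g0 := ground_ref_gt0 z.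
have H n : `|n| <= 2 * ground_ref z -> `|kap / 6 * n / ground_ref z| <= kap / 3.
  move=> hn; rewrite normrM normfV (gtr0_norm g0) ler_pdivrMr// normrM ger0_norm ?divr_ge0//.
  have -> : kap / 3 * ground_ref z = kap / 6 * (2 * ground_ref z) by field.
  by apply: ler_wpM2l; rewrite ?divr_ge0.
have := dsinh_le (phaseA z); have := dsinh_le (phaseB z); have := dsinh_le (phaseC z).
rewrite !ler_norml => /andP[c1 c2] /andP[b1 b2] /andP[a1 a2].
have cA := dcosh_gt0 (phaseA z); have cB := dcosh_gt0 (phaseB z); have cC := dcosh_gt0 (phaseC z).
by rewrite -!ler_norml; split; apply: H; rewrite ler_norml /ground_ref; apply/andP; split; lra.
Qed.

Variable rho : R.
Hypothesis hq1 : dsinh (kap - q) = rho * dcosh (kap - q).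
Hypothesis hq2 : dsinh (kap / 2 + q) = 2 * rho * dcosh (kap / 2 + q).

(** On a side one phase is constant and so is the sum of the two others, and the
    sum-to-product formulas turn the Robin condition into the two equations that
    define kap and q. *)
Lemma side_ratio x y w : w = kap - q -> x + y = - (kap + 2 * q) ->
  2 * dsinh w - dsinh x - dsinh y = 2 * rho * (dcosh x + dcosh y + dcosh w).
Proof.
move=> -> xy; rewrite hq1 -[LHS]/(_ - _ - _) -addrA -opprD dsinhD dcoshD xy.
have -> : - (kap + 2 * q) / 2 = - (kap / 2 + q) by field.
rewrite dsinhN dcoshN hq2; ring.
Qed.

Lemma flux_BC t : flow1 (1 - t, t) + flow2 (1 - t, t) = kap * rho / 3.
Proof.
have g0 := ground_ref_gt0 (1 - t, t).
have := @side_ratio (phaseB (1 - t, t)) (phaseC (1 - t, t)) (phaseA (1 - t, t)).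
rewrite /flow1 /flow2 => h; rewrite -mulrDl; apply: (@mulIf _ (ground_ref (1 - t, t))); first by rewrite gt_eqF.
rewrite divfK ?gt_eqF// /ground_ref.
have {}h := h ltac:(rewrite /phaseA/=; ring) ltac:(rewrite /phaseB /phaseC/=; ring).
transitivity (kap / 6 * (2 * dsinh (phaseA (1 - t, t)) - dsinh (phaseB (1 - t, t)) - dsinh (phaseC (1 - t, t)))); first by ring.
by rewrite h; field.
Qed.

Lemma flux_CA t : - flow1 (0, t) = kap * rho / 3.
Proof.
have g0 := ground_ref_gt0 (0, t).
have := @side_ratio (phaseA (0, t)) (phaseC (0, t)) (phaseB (0, t)).
rewrite /flow1 => h; rewrite -mulNr; apply: (@mulIf _ (ground_ref (0, t))); first by rewrite gt_eqF.
rewrite divfK ?gt_eqF// /ground_ref.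
have {}h := h ltac:(rewrite /phaseB/=; ring) ltac:(rewrite /phaseA /phaseC/=; ring).
transitivity (kap / 6 * (2 * dsinh (phaseB (0, t)) - dsinh (phaseA (0, t)) - dsinh (phaseC (0, t)))); first by ring.
by rewrite h; field.
Qed.

Lemma flux_AB t : - flow2 (t, 0) = kap * rho / 3.
Proof.
have g0 := ground_ref_gt0 (t, 0).
have := @side_ratio (phaseA (t, 0)) (phaseB (t, 0)) (phaseC (t, 0)).
rewrite /flow2 => h; rewrite -mulNr; apply: (@mulIf _ (ground_ref (t, 0))); first by rewrite gt_eqF.
rewrite divfK ?gt_eqF// /ground_ref.
have {}h := h ltac:(rewrite /phaseC/=; ring) ltac:(rewrite /phaseA /phaseB/=; ring).
transitivity (kap / 6 * (2 * dsinh (phaseC (t, 0)) - dsinh (phaseA (t, 0)) - dsinh (phaseB (t, 0)))); first by ring.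
by rewrite h; field.
Qed.

End ground_state.

(** * The identity of Barta *)

(** Both fields are differentiated only along their own coordinate axis, hence
    the hypotenuse sees their sum and each leg only one of them. *)
Lemma simplex_divergence (R : realType) (f f1 f2 g g1 g2 : R * R -> R) : C1 f f1 f2 -> C1 g g1 g2 ->
  simplex_int (fun z => f1 z + g2 z) =
  unit_int (fun t => f (1 - t, t) + g (1 - t, t) - f (0, t) - g (t, 0)).
Proof.
move=> [cf cf1 _ df1 _] [cg _ cg2 _ dg2].
have c1m : continuous (fun x : R => 1 - x).
  by move=> x; apply: cvgB; [exact: cvg_cst|exact: cvg_id].
have ci : continuous (fun x : R => x) by move=> x; exact: cvg_id.
have cc : continuous (fun _ : R => 0 : R) by move=> x; exact: cvg_cst.
have cp (k : R * R -> R) (l m : R -> R) : continuous k -> continuous l -> continuous m ->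
    continuous (fun x => k (l x, m x)) by move=> *; exact: continuous_comp_pair.
have cs (k l : R -> R) : continuous k -> continuous l -> continuous (fun x => k x + l x).
  by move=> ck cl x; apply: cvgD; [exact: ck|exact: cl].
have cd (k l : R -> R) : continuous k -> continuous l -> continuous (fun x => k x - l x).
  by move=> ck cl x; apply: cvgB; [exact: ck|exact: cl].
have b1 := cp _ _ _ cf c1m ci; have b2 := cp _ _ _ cg c1m ci.
have b3 := cp _ _ _ cf cc ci; have b4 := cp _ _ _ cg ci cc.
have b5 := cp _ _ _ cg ci c1m.
rewrite simplex_intD// (simplex_int_partial1 cf cf1 df1) (simplex_int_partial2 cg cg2 dg2).
rewrite (unit_intB (cd _ _ (cs _ _ b1 b2) b3) b4) (unit_intB (cs _ _ b1 b2) b3) (unit_intD b1 b2) (unit_intB b1 b3) (unit_intB b5 b4).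
by have := unit_int_onem b2; under eq_fun do rewrite subKr; move=> ->; ring.
Qed.

Section barta.
Context {R : realType}.
Variables (kap q rho : R).
Hypothesis hq1 : dsinh (kap - q) = rho * dcosh (kap - q).
Hypothesis hq2 : dsinh (kap / 2 + q) = 2 * rho * dcosh (kap / 2 + q).
Local Notation flow1 := (flow1 kap q).
Local Notation flow2 := (flow2 kap q).

Definition side_sum (c a h : R) (phi : R * R -> R) : R :=
  side_mean (- c, 0) (c, 0) phi + side_mean (c, 0) (a, h) phi + side_mean (a, h) (- c, 0) phi.

(** (fieldx, fieldy) are the Cartesian components of the field t * flow, carried
    to the triangle by its edge vectors (2 c, 0) and (a + c, h). *)
Definition fieldx (c a t : R) (z : R * R) : R := t * (2 * c * flow1 z + (a + c) * flow2 z).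
Definition fieldy (h t : R) (z : R * R) : R := t * (h * flow2 z).
(** The divergence of the carried field plus its squared length. *)
Definition potential (c a h t : R) (z : R * R) : R :=
  t * (kap ^+ 2 - 12 * (flow1 z ^+ 2 + flow1 z * flow2 z + flow2 z ^+ 2)) + fieldx c a t z ^+ 2 + fieldy h t z ^+ 2.
(** The square |grad phi - phi X| ^ 2 for the carried field X. *)
Definition defect (c a h t : R) (phi : R * R -> R) (z : R * R) : R :=
  (partial1 phi (simplex_map c a h z) - phi (simplex_map c a h z) * fieldx c a t z) ^+ 2 +
  (partial2 phi (simplex_map c a h z) - phi (simplex_map c a h z) * fieldy h t z) ^+ 2.

Lemma side_sumE (c a h : R) phi : continuous phi -> side_sum c a h phi =
  unit_int (fun t => phi (simplex_map c a h (t, 0)) ^+ 2) + unit_int (fun t => phi (simplex_map c a h (1 - t, t)) ^+ 2) +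
  unit_int (fun t => phi (simplex_map c a h (0, t)) ^+ 2).
Proof.
move=> cphi; rewrite /side_sum /side_mean; congr (_ + _ + _).
- by congr unit_int; apply/funext => t; rewrite /segment_point /simplex_map/=; congr (phi (_, _) ^+ 2); ring.
- by congr unit_int; apply/funext => t; rewrite /segment_point /simplex_map/=; congr (phi (_, _) ^+ 2); ring.
- rewrite -[in RHS]unit_int_onem; last first.
    apply: continuous_sqr; apply: (@continuous_pair2 _ (phi \o simplex_map c a h)).
    exact: continuous_simplex_map_comp.
  by congr unit_int; apply/funext => t; rewrite /segment_point /simplex_map/=; congr (phi (_, _) ^+ 2); ring.
Qed.

Lemma continuous_potential (c a h t : R) : continuous (potential c a h t).
Proof.
have [Y11 [Y12 [Y21 [Y22 [[cY1 _ _ _ _] [cY2 _ _ _ _] _]]]]] := flow_divergence kap q.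
have cc (k : R) : continuous (fun _ : R * R => k) by move=> z; exact: cvg_cst.
move=> z; apply: cvgD; last first.
  by apply: continuous_sqr => w; apply: cvgM; [exact: cc|apply: cvgM; [exact: cc|exact: cY2]].
apply: cvgD; last first.
  apply: continuous_sqr => w; apply: cvgM; first exact: cc.
  by apply: cvgD; (apply: cvgM; [exact: cc|]); [exact: cY1|exact: cY2].
apply: cvgM; first exact: cc.
apply: cvgB; first exact: cc.
apply: cvgM; first exact: cc.
apply: cvgD; last exact: continuous_sqr.
by apply: cvgD; [exact: continuous_sqr|apply: cvgM; [exact: cY1|exact: cY2]].
Qed.

(** Expand |grad phi - phi X| ^ 2 and apply the divergence theorem to phi ^ 2 X.
    The flux of X through each side is constant, so the boundary term is a
    multiple of the integral of phi ^ 2 over the sides. *)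
Lemma barta_identity (c a h t : R) (phi : R * R -> R) : smooth phi ->
  energy c a h phi = 2 * c * h * (t * (kap * rho / 3 * side_sum c a h phi)
    - simplex_int (fun z => phi (simplex_map c a h z) ^+ 2 * potential c a h t z) + simplex_int (defect c a h t phi)).
Proof.
move=> /smooth_C1 Cphi; have [cphi cphi1 cphi2 _ _] := Cphi.
have [Y11 [Y12 [Y21 [Y22 [CY1 CY2 divY]]]]] := flow_divergence kap q.
have [cY1 cY11 _ _ _] := CY1; have [cY2 _ cY22 _ _] := CY2.
have Ct := C1_simplex_map c a h Cphi.
have Cf := C1_mul (C1_mul Ct Ct) CY1; have Cg := C1_mul (C1_mul Ct Ct) CY2.
have [cf cf1 _ df1 _] := Cf; have [cg _ cg2 _ dg2] := Cg.
pose P z := phi (simplex_map c a h z).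
pose P1 z := 2 * c * partial1 phi (simplex_map c a h z).
pose P2 z := (a + c) * partial1 phi (simplex_map c a h z) + h * partial2 phi (simplex_map c a h z).
pose f1 z := (P1 z * P z + P z * P1 z) * flow1 z + P z * P z * Y11 z.
pose g2 z := (P2 z * P z + P z * P2 z) * flow2 z + P z * P z * Y22 z.
have Jdiv : simplex_int (fun z => f1 z + g2 z) = _ := simplex_divergence Cf Cg.
have ca (k : R * R -> R) : continuous k -> continuous (fun z => k (simplex_map c a h z)).
  by move=> ck; exact: continuous_simplex_map_comp.
have cM (k l : R * R -> R) : continuous k -> continuous l -> continuous (fun z => k z * l z).
  by move=> ck cl z; apply: cvgM; [exact: ck|exact: cl].
have cD (k l : R * R -> R) : continuous k -> continuous l -> continuous (fun z => k z + l z).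
  by move=> ck cl z; apply: cvgD; [exact: ck|exact: cl].
have cB (k l : R * R -> R) : continuous k -> continuous l -> continuous (fun z => k z - l z).
  by move=> ck cl z; apply: cvgB; [exact: ck|exact: cl].
have cc (k : R) : continuous (fun _ : R * R => k) by move=> z; exact: cvg_cst.
have cfx : continuous (fieldx c a t).
  by apply: (cM _ _ (cc t)); apply: (cD _ _); apply: (cM _ _ (cc _)).
have cfy : continuous (fieldy h t).
  by apply: (cM _ _ (cc t)); apply: (cM _ _ (cc _)).
have cpot := @continuous_potential c a h t.
have cdef : continuous (defect c a h t phi).
  by apply: (cD _ _); apply: continuous_sqr; apply: (cB _ _); try exact: ca; apply: (cM _ _) => //; exact: ca.
have cpp : continuous (fun z => phi (simplex_map c a h z) ^+ 2 * potential c a h t z).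
  by apply: (cM _ _) => //; apply: continuous_sqr; exact: ca.
have -> : kap * rho / 3 * side_sum c a h phi = simplex_int (fun z => f1 z + g2 z).
  rewrite Jdiv side_sumE//.
  have cseg (l m : R -> R) : continuous l -> continuous m ->
      continuous (fun x => phi (simplex_map c a h (l x, m x)) ^+ 2).
    by move=> cl cm; apply: continuous_sqr; exact: (continuous_comp_pair (ca _ cphi) cl cm).
  have c1m : continuous (fun x : R => 1 - x).
    by move=> x; apply: cvgB; [exact: cvg_cst|exact: cvg_id].
  have ci : continuous (fun x : R => x) by move=> x; exact: cvg_id.
  have c0 : continuous (fun _ : R => 0 : R) by move=> x; exact: cvg_cst.
  have b1 := cseg _ _ ci c0; have b2 := cseg _ _ c1m ci; have b3 := cseg _ _ c0 ci.
  have b12 : continuous (fun x : R => phi (simplex_map c a h (x, 0)) ^+ 2 + phi (simplex_map c a h (1 - x, x)) ^+ 2).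
    by move=> x; apply: cvgD; [exact: b1|exact: b2].
  have b123 : continuous (fun x : R => phi (simplex_map c a h (x, 0)) ^+ 2 + phi (simplex_map c a h (1 - x, x)) ^+ 2
      + phi (simplex_map c a h (0, x)) ^+ 2).
    by move=> x; apply: cvgD; [exact: b12|exact: b3].
  rewrite -(unit_intD b1 b2) -(unit_intD b12 b3) -(unit_intZ _ b123).
  congr unit_int; apply/funext => x /=; rewrite !mulrDr.
  by rewrite -{1}(flux_AB hq1 hq2 x) -{1}(flux_BC hq1 hq2 x) -{1}(flux_CA hq1 hq2 x); ring.
have cfg : continuous (fun z => f1 z + g2 z) by move=> z; apply: cvgD; [exact: cf1|exact: cg2].
rewrite /energy /mass -mulrDr -simplex_intD; last 2 first.
- by apply: continuous_sqr; exact: ca.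
- by apply: continuous_sqr; exact: ca.
have ctfg : continuous (fun z => t * (f1 z + g2 z)) by exact: (cM _ _ (cc t) cfg).
congr (_ * _); rewrite -(simplex_intZ _ cfg) -(simplex_intB ctfg cpp) -(simplex_intD (cB _ _ ctfg cpp) cdef).
congr simplex_int; apply/funext => z.
by rewrite /defect /potential -divY /f1 /g2 /fieldx /fieldy /P /P1 /P2; ring.
Qed.

(** Dropping the square in the identity bounds the energy from below by the
    boundary integral. *)
Lemma barta_lower (c a h t W : R) (phi : R * R -> R) : 0 < c -> 0 < h -> smooth phi ->
  (forall z, potential c a h t z <= W) ->
  2 * c * h * (t * (kap * rho / 3 * side_sum c a h phi)) - W * mass c a h phi <= energy c a h phi.
Proof.
move=> c0 h0 sphi hW; rewrite (barta_identity c a h t sphi).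
have [cphi _ _ _ _] := smooth_C1 sphi.
have ch0 : 0 <= 2 * c * h by rewrite ltW// !mulr_gt0.
have csq : continuous (fun z => phi (simplex_map c a h z) ^+ 2).
  by apply: continuous_sqr; exact: (continuous_simplex_map_comp cphi).
rewrite /mass [W * _]mulrCA -mulrBr ler_wpM2l//.
have J0 : 0 <= simplex_int (defect c a h t phi).
  by apply: simplex_int_ge0 => z; rewrite /defect addr_ge0// sqr_ge0.
have : simplex_int (fun z => phi (simplex_map c a h z) ^+ 2 * potential c a h t z) <= W * simplex_int (fun z => phi (simplex_map c a h z) ^+ 2).
  rewrite -simplex_intZ//; apply: le_simplex_int.
  - by move=> z; apply: cvgM; [exact: csq|exact: continuous_potential].
  - by move=> z; apply: cvgM; [exact: cvg_cst|exact: csq].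
  - by move=> z _; rewrite mulrC ler_wpM2r// sqr_ge0.
move=> ?; lra.
Qed.

(** The quadratic form in the divergence of the flow is the metric of the
    equilateral triangle, so the squared length of the field cancels it. *)
Lemma potential_equilateral (c h : R) (z : R * R) : 0 < c -> h ^+ 2 = 3 * c ^+ 2 ->
  potential c 0 h (3 / c ^+ 2) z = 3 * kap ^+ 2 / c ^+ 2.
Proof.
move=> c0 hc; rewrite /potential /fieldx /fieldy.
rewrite (_ : (_ * (h * _)) ^+ 2 = (3 / c ^+ 2) ^+ 2 * (3 * c ^+ 2) * flow2 z ^+ 2); last first.
  by rewrite -hc; ring.
field; lra.
Qed.

End barta.

(** * The lowest eigenvalue of the equilateral triangle *)

Section smooth_exponentials.
Context {R : realType}.
Implicit Types f g : R * R -> R.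

Lemma smoothD f g : smooth f -> smooth g -> smooth (fun z => f z + g z).
Proof.
move=> sf sg k; move: (sf k) (sg k) => {sf sg}.
elim: k f g => [|k IH] f g /=.
  by move=> [cf _] [cg _]; split=> // z; apply: cvgD; [exact: cf|exact: cg].
move=> [cf [df1 df2 f1 f2]] [cg [dg1 dg2 g1 g2]].
split; first by move=> z; apply: cvgD; [exact: cf|exact: cg].
split.
- by move=> z; apply: derivableD; [exact: df1|exact: dg1].
- by move=> z; apply: derivableD; [exact: df2|exact: dg2].
- rewrite (_ : partial1 _ = (fun z => partial1 f z + partial1 g z)); first exact: IH.
  apply/funext => z; rewrite /partial1 !derive1E.
  by rewrite (_ : (fun t => _) = (fun t => f (t, z.2)) + (fun t => g (t, z.2)))// deriveD.
- rewrite (_ : partial2 _ = (fun z => partial2 f z + partial2 g z)); first exact: IH.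
  apply/funext => z; rewrite /partial2 !derive1E.
  by rewrite (_ : (fun t => _) = (fun t => f (z.1, t)) + (fun t => g (z.1, t)))// deriveD.
Qed.

Lemma smooth_exp (m k0 k1 k2 : R) : smooth (fun z => m * expR (k0 + k1 * z.1 + k2 * z.2)).
Proof.
have C (m' : R) : C1 (fun z => m' * expR (k0 + k1 * z.1 + k2 * z.2))
   (fun z => m' * k1 * expR (k0 + k1 * z.1 + k2 * z.2))
   (fun z => m' * k2 * expR (k0 + k1 * z.1 + k2 * z.2)).
  have h := C1_comp (@continuous_expR R) (@is_derive_expR R) (C1_lin k0 k1 k2).
  by apply: (C1_ext (C1_mul (C1_cst m') h)) => z //=; ring.
move=> k; elim: k m => [|k IH] m; have [cf _ _ df1 df2] := C m; split => //.
split.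
- by move=> z; have [] := df1 z.
- by move=> z; have [] := df2 z.
- rewrite (_ : partial1 _ = (fun z => m * k1 * expR (k0 + k1 * z.1 + k2 * z.2))); first exact: IH.
  by apply/funext => z; rewrite /partial1 derive1E; have h := df1 z; exact: derive_val.
- rewrite (_ : partial2 _ = (fun z => m * k2 * expR (k0 + k1 * z.1 + k2 * z.2))); first exact: IH.
  by apply/funext => z; rewrite /partial2 derive1E; have h := df2 z; exact: derive_val.
Qed.

Lemma smooth_dcosh (k0 k1 k2 : R) : smooth (fun z => dcosh (k0 + k1 * z.1 + k2 * z.2)).
Proof.
have := smoothD (smooth_exp 1 k0 k1 k2) (smooth_exp 1 (- k0) (- k1) (- k2)).
rewrite (_ : (fun z => _ + _) = (fun z => dcosh (k0 + k1 * z.1 + k2 * z.2)))//.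
by apply/funext => z; rewrite !mul1r /dcosh; congr (_ + expR _); ring.
Qed.

(** Used to read off the partial derivatives of the ground state on the triangle
    from those on the simplex. *)
Lemma C1_unique f f1 f2 g1 g2 : C1 f f1 f2 -> C1 f g1 g2 -> f1 =1 g1 /\ f2 =1 g2.
Proof.
move=> [_ _ _ h1 h2] [_ _ _ k1 k2]; split=> z.
  by have a := h1 z; have b := k1 z; rewrite -(derive_val (is_derive := a)) -(derive_val (is_derive := b)).
by have a := h2 z; have b := k2 z; rewrite -(derive_val (is_derive := a)) -(derive_val (is_derive := b)).
Qed.

Lemma simplex_mapK (c a h : R) z : 0 < c -> 0 < h -> simplex_map_inv c a h (simplex_map c a h z) = z.
Proof.
move=> c0 h0; case: z => x y; rewrite /simplex_map /simplex_map_inv/=; congr pair; field; rewrite ?gt_eqF//.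
Qed.

Lemma dcosh_ge1 (x : R) : 1 <= dcosh x.
Proof.
have h1 := expR_ge1Dx x; have h2 := expR_ge1Dx (- x); have h3 := expR_gt0 x; have h4 := expR_gt0 (- x).
rewrite /dcosh; lra.
Qed.

Lemma simplex_int1 : simplex_int (fun _ : R * R => 1) = 1 / 2 :> R.
Proof.
have ci : continuous (fun x : R => x) by move=> x; exact: cvg_id.
have c1m : continuous (fun x : R => 1 - x).
  by move=> x; apply: cvgB; [exact: cvg_cst|exact: cvg_id].
have c1 : continuous (fun _ : R * R => 1 : R) by move=> z; exact: cvg_cst.
rewrite (simplex_int_partial1 (@continuous_fst2 R) c1 (fun z => is_derive_id z.1 1)).
have e1 := unit_int_onem ci.
have e2 : unit_int (fun t : R => (1 - t) + t) = 1.
  rewrite (_ : (fun t => _) = cst 1); last by apply/funext => t /=; ring.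
  rewrite /unit_int Rintegral_cst; last exact: measurable_itv.
  set m := fine _; have -> : m = fine (@lebesgue_measure R `[0, 1]%classic) by []. by rewrite lebesgue_measure_itv/= lte_fin ltr01 oppr0 addr0 mul1r.
rewrite (unit_intD c1m ci) e1 in e2.
rewrite (_ : (fun t => _) = (fun t => 1 - t)); last by apply/funext => t; rewrite /= subr0.
rewrite e1; lra.
Qed.

End smooth_exponentials.

Section equilateral.
Context {R : realType}.
Variables (kap q rho c h : R).
Hypothesis hq1 : dsinh (kap - q) = rho * dcosh (kap - q).
Hypothesis hq2 : dsinh (kap / 2 + q) = 2 * rho * dcosh (kap / 2 + q).
Hypotheses (c0 : 0 < c) (h0 : 0 < h) (hc : h ^+ 2 = 3 * c ^+ 2).

Lemma boundary_form_equilateral phi : boundary_form (base_triangle c 0 h) phi = 2 * c * side_sum c 0 h phi.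
Proof.
have e (x : R) : x = 4 * c ^+ 2 -> Num.sqrt x = 2 * c.
  by move=> ->; rewrite (_ : 4 * c ^+ 2 = (2 * c) ^+ 2) ?sqrtr_sqr ?gtr0_norm ?mulr_gt0//; ring.
have e1 : segment_length (- c, 0) (c, 0) = 2 * c by apply: e => /=; ring.
have e2 : segment_length (c, 0) (0, h) = 2 * c by apply: e => /=; rewrite subr0 hc; ring.
have e3 : segment_length (0, h) (- c, 0) = 2 * c.
  by apply: e => /=; rewrite sub0r sqrrN hc; ring.
by rewrite /boundary_form /side_sum /= e1 e2 e3; ring.
Qed.

Definition ground (x : R * R) : R := ground_ref kap q (simplex_map_inv c 0 h x).

Lemma smooth_ground : smooth ground.
Proof.
have := smoothD (smoothD (smooth_dcosh (- (kap / 2) - q) (3 * kap / (2 * c)) (3 * kap / (2 * h)))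
  (smooth_dcosh (- (kap / 2) - q) (- (3 * kap / (2 * c))) (3 * kap / (2 * h))))
  (smooth_dcosh (kap - q) 0 (- (3 * kap / h))).
rewrite (_ : (fun z => _ + _) = ground)//; apply/funext => z.
by rewrite /ground /ground_ref /phaseA /phaseB /phaseC /simplex_map_inv/=; congr (dcosh _ + dcosh _ + dcosh _); field; rewrite ?(gt_eqF c0) ?(gt_eqF h0).
Qed.

Lemma ground_simplex_map z : ground (simplex_map c 0 h z) = ground_ref kap q z.
Proof. by rewrite /ground simplex_mapK. Qed.

(** The ground state u satisfies grad u = u X, so the square in the identity of
    Barta vanishes. *)
Lemma ground_defect : defect kap q c 0 h (3 / c ^+ 2) ground = fun=> 0.
Proof.
have := C1_simplex_map c 0 h (smooth_C1 smooth_ground).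
rewrite (_ : ground \o _ = ground_ref kap q); last by apply/funext => z; exact: ground_simplex_map.
move=> /C1_unique /(_ (C1_ground_ref kap q)) [e1 e2].
apply/funext => z; rewrite /defect ground_simplex_map.
have {}e1 := e1 z; have {}e2 := e2 z.
have g0 := ground_ref_gt0 kap q z.
have -> : partial1 ground (simplex_map c 0 h z) = ground_ref1 kap q z / (2 * c).
  by rewrite -e1; field; rewrite ?(gt_eqF c0) ?(gt_eqF h0) ?(gt_eqF g0).
have -> : partial2 ground (simplex_map c 0 h z) = (ground_ref2 kap q z - ground_ref1 kap q z / 2) / h.
  by rewrite -e2 -e1; field; rewrite ?(gt_eqF c0) ?(gt_eqF h0) ?(gt_eqF g0).
rewrite /fieldx /fieldy /flow1 /flow2 /ground_ref1 /ground_ref2.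
set A := dsinh _; set B := dsinh _; set C := dsinh _; set G := ground_ref _ _ _ in g0 *.
rewrite (_ : _ - _ = 0); last by field; rewrite ?(gt_eqF c0) ?(gt_eqF h0) ?(gt_eqF g0).
rewrite (_ : _ - _ = 0); last first.
  have hi : 3 / c ^+ 2 = 9 / h ^+ 2 by rewrite hc; field; rewrite ?(gt_eqF c0) ?(gt_eqF h0) ?(gt_eqF g0).
  by rewrite hi; field; rewrite ?(gt_eqF c0) ?(gt_eqF h0) ?(gt_eqF g0).
by rewrite expr0n addr0.
Qed.

Let s := h * kap * rho / c ^+ 2.

(** For the ground state the identity of Barta has no square term and gives the
    quotient - k ^ 2; for all other functions the square is nonnegative. *)
Lemma lambda1_equilateral : lambda1 (- s) (base_triangle c 0 h) = (- (3 * kap ^+ 2 / c ^+ 2))%:E.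
Proof.
have flux phi : 2 * c * h * (3 / c ^+ 2 * (kap * rho / 3 * side_sum c 0 h phi)) =
    s * boundary_form (base_triangle c 0 h) phi.
  by rewrite boundary_form_equilateral /s; field; rewrite ?(gt_eqF c0).
apply/eqP; rewrite eq_le; apply/andP; split.
- have [cg _ _ _ _] := smooth_C1 smooth_ground.
  have M0 : 0 < mass c 0 h ground.
    rewrite /mass mulr_gt0 ?mulr_gt0//.
    apply: (@lt_le_trans _ _ (simplex_int (fun _ : R * R => 1))); first by rewrite simplex_int1; lra.
    apply: le_simplex_int; first by move=> z; exact: cvg_cst.
      by apply: continuous_sqr; exact: continuous_simplex_map_comp.
    move=> z _; rewrite ground_simplex_map /ground_ref -[leLHS](expr1n _ 2) ler_sqr ?nnegrE ?ltW ?ground_ref_gt0//.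
    have h1 := dcosh_ge1 (phaseA kap q z); have h2 := dcosh_gt0 (phaseB kap q z); have h3 := dcosh_gt0 (phaseC kap q z); lra.
  apply: (le_trans (lambda1_le_smooth (- s) c0 h0 smooth_ground M0)).
  rewrite lee_fin ler_pdivrMr// (barta_identity hq1 hq2 _ _ _ (3 / c ^+ 2) smooth_ground).
  rewrite ground_defect (_ : (fun z => _ * potential _ _ _ _ _ _ _) =
     (fun z => 3 * kap ^+ 2 / c ^+ 2 * ground (simplex_map c 0 h z) ^+ 2)); last first.
    by apply/funext => z; rewrite potential_equilateral// mulrC.
  rewrite simplex_intZ; last by apply: continuous_sqr; exact: (continuous_simplex_map_comp cg).
  have -> : simplex_int (fun _ : R * R => 0) = 0 :> R.
    by rewrite /simplex_int /Rintegral integral0_eq.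
  have := flux ground; rewrite /mass; set M := simplex_int _; set Ss := side_sum _ _ _ _ => e.
  lra.
- rewrite leNgt; apply/negP => /(smooth_below c0 h0)[phi [sphi M0]].
  have := barta_lower hq1 hq2 c0 h0 sphi (t := 3 / c ^+ 2) (a := 0) (W := 3 * kap ^+ 2 / c ^+ 2).
  rewrite flux => H; have {}H := H (fun z => ltac:(by rewrite potential_equilateral)).
  move=> ?; lra.
Qed.

End equilateral.

(** * Dilations *)

Section dilation.
Context {R : realType}.

Lemma C1_dilate (w m : R) (f f1 f2 : R * R -> R) : C1 f f1 f2 ->
  C1 (fun z => m * f (w * z.1, w * z.2)) (fun z => m * w * f1 (w * z.1, w * z.2))
     (fun z => m * w * f2 (w * z.1, w * z.2)).
Proof.
move=> Cf; have [cf cf1 cf2 _ _] := Cf.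
have cw1 : continuous (fun z : R * R => w * z.1).
  by move=> z; apply: cvgM; [exact: cvg_cst|exact: continuous_fst2].
have cw2 : continuous (fun z : R * R => w * z.2).
  by move=> z; apply: cvgM; [exact: cvg_cst|exact: continuous_snd2].
have cd k (l : R * R -> R) : continuous l -> continuous (fun z => k * l (w * z.1, w * z.2)).
  by move=> cl z; apply: cvgM; [exact: cvg_cst|exact: (continuous_comp_pair cl cw1 cw2)].
split; [exact: cd|exact: cd|exact: cd| |] => -[x y] /=.
- have h := is_derive_mul (is_derive_cst m x 1) (C1_chain 0 (w * y) w 0 x Cf).
  rewrite (_ : (fun t => _) = (fun t => m * f (0 + w * t, w * y + 0 * t))); last first.
    by apply/funext => t; rewrite add0r mul0r addr0.
  by apply: (is_derive_eq h); rewrite /= !add0r !mul0r !addr0 add0r mulrA.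
- have h := is_derive_mul (is_derive_cst m y 1) (C1_chain (w * x) 0 0 w y Cf).
  rewrite (_ : (fun t => _) = (fun t => m * f (w * x + 0 * t, 0 + w * t))); last first.
    by apply/funext => t; rewrite add0r mul0r addr0.
  by apply: (is_derive_eq h); rewrite /= !add0r !mul0r !addr0 !add0r mulrA.
Qed.

Lemma smooth_dilate (w m : R) (f : R * R -> R) : smooth f -> smooth (fun z => m * f (w * z.1, w * z.2)).
Proof.
move=> sf k; move: (sf k) => {sf}; elim: k m f => [|k IH] m f.
  move=> [cf _]; split=> //.
  have cw1 : continuous (fun z : R * R => w * z.1).
    by move=> z; apply: cvgM; [exact: cvg_cst|exact: continuous_fst2].
  have cw2 : continuous (fun z : R * R => w * z.2).
    by move=> z; apply: cvgM; [exact: cvg_cst|exact: continuous_snd2].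
  by move=> z; apply: cvgM; [exact: cvg_cst|exact: (continuous_comp_pair cf cw1 cw2)].
move=> Cf; have C1f := C1_dilate w m (Ck_C1 Cf).
have [e1 e2] := C1_partial C1f; have [cd _ _ d1 d2] := C1f.
split=> //; rewrite e1 e2; split; try by apply: IH; case: Cf => _ [].
- by move=> z; have [] := d1 z.
- by move=> z; have [] := d2 z.
Qed.

Lemma mass_dilate (g c a h k : R) (f : R * R -> R) : g != 0 -> continuous f ->
  mass (g * c) (g * a) (g * h) (fun z => k * f (g^-1 * z.1, g^-1 * z.2)) = (g * k) ^+ 2 * mass c a h f.
Proof.
move=> g0 cf; rewrite /mass.
have -> : (fun z => (k * f (g^-1 * (simplex_map (g * c) (g * a) (g * h) z).1, g^-1 * (simplex_map (g * c) (g * a) (g * h) z).2)) ^+ 2)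
    = (fun z => k ^+ 2 * f (simplex_map c a h z) ^+ 2).
  apply/funext => z; rewrite exprMn; congr (_ * f _ ^+ 2).
  by rewrite /simplex_map/=; congr pair; field.
rewrite simplex_intZ; last by apply: continuous_sqr; exact: (continuous_simplex_map_comp cf).
ring.
Qed.

Lemma energy_dilate (g c a h : R) (f : R * R -> R) : g != 0 -> smooth f ->
  energy (g * c) (g * a) (g * h) (fun z => 1 * f (g^-1 * z.1, g^-1 * z.2)) = energy c a h f.
Proof.
move=> g0 sf; have [cf cf1 cf2 _ _] := smooth_C1 sf.
have [p1 p2] := C1_partial (C1_dilate g^-1 1 (smooth_C1 sf)).
rewrite /energy p1 p2 (mass_dilate _ _ _ _ g0 cf1) (mass_dilate _ _ _ _ g0 cf2).
by rewrite mul1r mulfV// expr1n; congr (_ + _); exact: mul1r.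
Qed.

Lemma boundary_form_dilate (g c a h : R) (f : R * R -> R) : 0 < g ->
  boundary_form (base_triangle (g * c) (g * a) (g * h)) (fun z => 1 * f (g^-1 * z.1, g^-1 * z.2)) =
  g * boundary_form (base_triangle c a h) f.
Proof.
move=> g0; have gn : g != 0 by rewrite gt_eqF.
have lg (p q : R * R) : segment_length (g * p.1, g * p.2) (g * q.1, g * q.2) = g * segment_length p q.
  rewrite /segment_length/= -!mulrBr !exprMn -mulrDr sqrtrM ?sqr_ge0//.
  by rewrite sqrtr_sqr gtr0_norm.
have sg (p q : R * R) : side_mean (g * p.1, g * p.2) (g * q.1, g * q.2)
    (fun z => 1 * f (g^-1 * z.1, g^-1 * z.2)) = side_mean p q f.
  rewrite /side_mean; congr unit_int; apply/funext => t; rewrite /segment_point/= mul1r.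
  by congr (f (_, _) ^+ 2); field.
rewrite /boundary_form /=.
have e1 : (- (g * c), 0) = (g * (- c), g * 0) by rewrite mulrN mulr0.
have e2 : (g * c, 0) = (g * c, g * 0) by rewrite mulr0.
rewrite e1 e2 (lg (- c, 0) (c, 0)) (lg (c, 0) (a, h)) (lg (a, h) (- c, 0)).
rewrite (sg (- c, 0) (c, 0)) (sg (c, 0) (a, h)) (sg (a, h) (- c, 0)); ring.
Qed.

(** Under the dilation by g the energy is unchanged, boundary integrals are
    multiplied by g and area integrals by g ^ 2, so smallness of the eigenvalue on
    the dilated triangle can be tested on the original one with parameter
    alpha * g. *)
Lemma lambda1_dilate (alpha g c a h m : R) (f : R * R -> R) : 0 < g -> 0 < c -> 0 < h -> smooth f ->
  0 < mass c a h f ->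
  energy c a h f + alpha * g * boundary_form (base_triangle c a h) f < m * g ^+ 2 * mass c a h f ->
  (lambda1 alpha (dilate g (base_triangle c a h)) < m%:E)%E.
Proof.
move=> g0 c0 h0 sf M0 hlt.
have gn : g != 0 by rewrite gt_eqF.
have -> : dilate g (base_triangle c a h) = base_triangle (g * c) (g * a) (g * h).
  by rewrite /dilate /dilate_point /base_triangle/= mulr0 mulrN.
have [cf _ _ _ _] := smooth_C1 sf.
have sF := smooth_dilate g^-1 1 sf.
have MF := mass_dilate c a h 1 gn cf; rewrite mulr1 in MF.
have MF0 : 0 < mass (g * c) (g * a) (g * h) (fun z => 1 * f (g^-1 * z.1, g^-1 * z.2)).
  by rewrite MF; apply: mulr_gt0; [exact: exprn_gt0|exact: M0].
apply: (le_lt_trans (lambda1_le_smooth alpha (mulr_gt0 g0 c0) (mulr_gt0 g0 h0) sF MF0)).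
rewrite lte_fin (ltr_pdivrMr _ _ MF0) (energy_dilate _ _ _ gn sf) (boundary_form_dilate _ _ _ _ g0) MF.
by rewrite [alpha * _]mulrA [m * _]mulrA.
Qed.

End dilation.

(** * Triangles close to the equilateral one *)

Section area_family.
Context {R : realType}.
Variable S : R.
Hypothesis hS : 0 < S.
Let c0 := c_eq S.
Let h0 := S / c0.

Lemma c_eq_gt0 : 0 < c0.
Proof. by rewrite /c0 /c_eq sqrtr_gt0 divr_gt0// sqrtr_gt0. Qed.

Lemma height_gt0 : 0 < h0.
Proof. by rewrite divr_gt0// c_eq_gt0. Qed.

Lemma height_eq : h0 = Num.sqrt 3 * c0.
Proof.
have c0p := c_eq_gt0; have s3 : 0 < Num.sqrt (3 : R) by rewrite sqrtr_gt0.
have e : S = Num.sqrt 3 * c0 ^+ 2.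
  rewrite /c0 /c_eq sqr_sqrtr; last by rewrite ltW// divr_gt0.
  by rewrite mulrC divfK// gt_eqF.
by rewrite /h0 {1}e expr2 mulrA mulfK// gt_eqF.
Qed.

Lemma height_sq : h0 ^+ 2 = 3 * c0 ^+ 2.
Proof. by rewrite height_eq exprMn sqr_sqrtr. Qed.

Lemma area_sq : S ^+ 2 = 3 * c0 ^+ 4.
Proof.
have c0p := c_eq_gt0; have -> : S = h0 * c0 by rewrite /h0 divfK// gt_eqF.
by rewrite exprMn height_sq; ring.
Qed.

(** The shift q is chosen so that kap - q and kap / 2 + q are the inverse
    hyperbolic tangents of rho and 2 * rho. *)
Lemma ground_params (s : R) : 0 < s -> exists rho kap q : R,
  [/\ [/\ 0 < rho, rho < 1 / 2 & 0 < kap],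
   dsinh (kap - q) = rho * dcosh (kap - q),
   dsinh (kap / 2 + q) = 2 * rho * dcosh (kap / 2 + q),
   h0 * kap * rho / c0 ^+ 2 = s &
   robin_param rho = s * c0 ^+ 2 / h0].
Proof.
move=> s0; have c0p := c_eq_gt0; have h0p := height_gt0.
have [rho [r0 r1 hr]] := @robin_param_onto R (s * c0 ^+ 2 / h0) ltac:(by rewrite divr_gt0// mulr_gt0// exprn_gt0).
exists rho, (wavenumber rho), (wavenumber rho - artanh rho); split=> //.
- by split=> //; exact: wavenumber_gt0.
- by rewrite subKr; apply: artanhP; lra.
- have -> : wavenumber rho / 2 + (wavenumber rho - artanh rho) = artanh (2 * rho).
    by rewrite /wavenumber; field.
  by apply: artanhP; lra.
- have -> : h0 * wavenumber rho * rho = h0 * robin_param rho by rewrite /robin_param mulrA.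
  rewrite hr; field.
  by rewrite (gt_eqF c0p) (gt_eqF h0p).
Qed.

Section one_parameter.
Variables (s rho kap q : R).
Hypotheses (rho0 : 0 < rho) (kap0 : 0 < kap).
Hypothesis hq1 : dsinh (kap - q) = rho * dcosh (kap - q).
Hypothesis hq2 : dsinh (kap / 2 + q) = 2 * rho * dcosh (kap / 2 + q).
Hypothesis hs : h0 * kap * rho / c0 ^+ 2 = s.

(** The eigenvalue of the equilateral triangle, in terms of s and rho. *)
Lemma kap_sq : 3 * kap ^+ 2 / c0 ^+ 2 = s ^+ 2 / rho ^+ 2.
Proof.
have c0p := c_eq_gt0.
have -> : s ^+ 2 = h0 ^+ 2 * (kap * rho / c0 ^+ 2) ^+ 2 by rewrite -hs; ring.
rewrite height_sq; field.
by rewrite (gt_eqF c0p) (gt_eqF rho0).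
Qed.

(** The field of the equilateral triangle is carried affinely to its neighbours.
    The product of its normal component on a side and the length of that side does
    not change, and its potential depends continuously on the triangle, so Barta's inequality
    holds with an error u uniform in the test function. *)
Lemma near_barta (u : R) : 0 < u -> \forall x \near ((0 : R), c0), 0 < x.2 ->
  forall f, smooth f ->
    s * (1 - u) * boundary_form (base_triangle x.2 x.1 (S / x.2)) f
      - (s ^+ 2 / rho ^+ 2 + u) * mass x.2 x.1 (S / x.2) f <= energy x.2 x.1 (S / x.2) f.
Proof.
move=> u0; have c0p := c_eq_gt0.
have s0 : 0 < s.
  rewrite -hs; apply: divr_gt0; last exact: exprn_gt0.
  by apply: mulr_gt0 => //; apply: mulr_gt0 => //; exact: height_gt0.
(* d bounds the change of the metric coefficients and of the squared side
   lengths; its two entries control the boundary term and the potential. *)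
pose d := Num.min (8 * c0 ^+ 2 * u) (u * c0 ^+ 4 / (3 * kap ^+ 2)).
have d0 : 0 < d.
  by rewrite /d lt_min !mulr_gt0 ?exprn_gt0 ?invr_gt0 ?mulr_gt0 ?exprn_gt0.
have d1 : d <= 8 * c0 ^+ 2 * u by rewrite /d ge_min lexx.
have d2 : d * (3 * kap ^+ 2) <= u * c0 ^+ 4.
  rewrite -ler_pdivlMr; first by rewrite /d ge_min lexx orbT.
  by rewrite mulr_gt0 ?exprn_gt0.
have cfst : continuous (fun x : R * R => x.1) := @continuous_fst2 R.
have csnd : continuous (fun x : R * R => x.2) := @continuous_snd2 R.
have nearG (G : R * R -> R) : {for (0, c0), continuous G} -> G (0, c0) = 4 * c0 ^+ 2 ->
    \forall x \near ((0 : R), c0), `|G x - 4 * c0 ^+ 2| <= d.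
  move=> cG <-; move/cvgrPdist_le : cG => /(_ d d0).
  by apply: filterS => x; rewrite distrC.
have cV : {for (0, c0), continuous (fun x : R * R => S / x.2)}.
  by apply: cvgM; [exact: cvg_cst|apply: cvgV; [rewrite /= gt_eqF|exact: csnd]].
have cV2 : {for (0, c0), continuous (fun x : R * R => (S / x.2) ^+ 2)}.
  by rewrite /prop_for /continuous_at; under eq_fun do rewrite expr2; rewrite expr2; apply: cvgM.
have cp : continuous (fun x : R * R => x.1 + x.2).
  by move=> x; apply: cvgD; [exact: cfst|exact: csnd].
have cm : continuous (fun x : R * R => x.1 - x.2).
  by move=> x; apply: cvgB; [exact: cfst|exact: csnd].
have n1 := nearG (fun x => 4 * x.2 ^+ 2) ltac:(apply: cvgM; [exact: cvg_cst|exact: (continuous_sqr csnd)]) erefl.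
have n2 := nearG (fun x => 4 * (x.2 * (x.1 + x.2)))
  ltac:(apply: cvgM; [exact: cvg_cst|apply: cvgM; [exact: csnd|exact: cp]]) ltac:(rewrite /= add0r; ring).
have n3 := nearG (fun x => (x.1 + x.2) ^+ 2 + (S / x.2) ^+ 2)
  ltac:(apply: cvgD; [exact: (continuous_sqr cp)|exact: cV2]) ltac:(rewrite /= -/h0 height_sq; ring).
have n4 := nearG (fun x => (x.1 - x.2) ^+ 2 + (S / x.2) ^+ 2)
  ltac:(apply: cvgD; [exact: (continuous_sqr cm)|exact: cV2]) ltac:(rewrite /= -/h0 height_sq; ring).
near=> x => x2 f sf.
have m1 : `|4 * x.2 ^+ 2 - 4 * c0 ^+ 2| <= d by near: x.
have m2 : `|4 * (x.2 * (x.1 + x.2)) - 4 * c0 ^+ 2| <= d by near: x.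
have m3 : `|(x.1 + x.2) ^+ 2 + (S / x.2) ^+ 2 - 4 * c0 ^+ 2| <= d by near: x.
have m4 : `|(x.1 - x.2) ^+ 2 + (S / x.2) ^+ 2 - 4 * c0 ^+ 2| <= d by near: x.
have hx : 0 < S / x.2 by rewrite divr_gt0.
have pot z : potential kap q x.2 x.1 (S / x.2) (3 / c0 ^+ 2) z <= s ^+ 2 / rho ^+ 2 + u.
  rewrite -kap_sq.
  have [b1 b2] := @flow_bound R kap q z (ltW kap0).
  pose y1 := flow1 kap q z; pose y2 := flow2 kap q z.
  have -> : potential kap q x.2 x.1 (S / x.2) (3 / c0 ^+ 2) z = 3 * kap ^+ 2 / c0 ^+ 2 + 9 / c0 ^+ 4 *
     ((4 * x.2 ^+ 2 - 4 * c0 ^+ 2) * (y1 * y1) + (4 * (x.2 * (x.1 + x.2)) - 4 * c0 ^+ 2) * (y1 * y2)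
      + ((x.1 + x.2) ^+ 2 + (S / x.2) ^+ 2 - 4 * c0 ^+ 2) * (y2 * y2)).
    by rewrite /potential /fieldx /fieldy -/y1 -/y2; field; rewrite (gt_eqF c0p) (gt_eqF x2).
  rewrite lerD2l.
  (* Each of the three changes of coefficients is at most d, and the components of
     the flow are at most kap / 3. *)
  have tb G p r : `|G| <= d -> `|p| <= kap / 3 -> `|r| <= kap / 3 -> G * (p * r) <= d * (kap / 3 * (kap / 3)).
    move=> hG hp hr; apply: (le_trans (ler_norm _)); rewrite !normrM.
    by apply: ler_pM => //; apply: ler_pM.
  have t1 := tb _ _ _ m1 b1 b1; have t2 := tb _ _ _ m2 b1 b2; have t3 := tb _ _ _ m3 b2 b2.
  apply: (@le_trans _ _ (9 / c0 ^+ 4 * (3 * (d * (kap / 3 * (kap / 3)))))).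
    by apply: ler_wpM2l; [rewrite divr_ge0// exprn_ge0// ltW|rewrite -/y1 -/y2 in t1 t2 t3; lra].
  have -> : 9 / c0 ^+ 4 * (3 * (d * (kap / 3 * (kap / 3)))) = d * (3 * kap ^+ 2) / c0 ^+ 4.
    by field; rewrite (gt_eqF c0p).
  by rewrite ler_pdivrMr ?exprn_gt0.
have := barta_lower hq1 hq2 x2 hx sf pot; apply: le_trans; rewrite lerD2r.
have -> : 2 * x.2 * (S / x.2) * (3 / c0 ^+ 2 * (kap * rho / 3 * side_sum x.2 x.1 (S / x.2) f)) =
   2 * c0 * s * side_sum x.2 x.1 (S / x.2) f.
  rewrite -hs /h0; field; by rewrite (gt_eqF c0p) (gt_eqF x2).
(* By the tangent inequality for the square root at 4 * c0 ^ 2. *)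
have len (p r : R * R) : (r.1 - p.1) ^+ 2 + (r.2 - p.2) ^+ 2 <= 4 * c0 ^+ 2 + d ->
    segment_length p r <= 2 * c0 * (1 + u).
  move=> hl; apply: (@le_trans _ _ (2 * c0 + d / (4 * c0))).
    rewrite /segment_length; set w := _ + _ in hl *.
    have w0 : 0 <= w by rewrite addr_ge0// sqr_ge0.
    have := sqr_ge0 (Num.sqrt w - 2 * c0); have := sqr_sqrtr w0.
    set y := Num.sqrt w => yw yc.
    have -> : 2 * c0 + d / (4 * c0) = (8 * c0 ^+ 2 + d) / (4 * c0).
      by field; rewrite (gt_eqF c0p).
    by rewrite ler_pdivlMr ?mulr_gt0//; nra.
  rewrite mulrDr mulr1 lerD2l ler_pdivrMr ?mulr_gt0//; apply: (le_trans d1).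
  by rewrite le_eqVlt; apply/orP; left; apply/eqP; ring.
have l1 : segment_length (- x.2, 0) (x.2, 0) <= 2 * c0 * (1 + u).
  by apply: len => /=; move: m1; rewrite ler_norml => /andP[_]; lra.
have l2 : segment_length (x.2, 0) (x.1, S / x.2) <= 2 * c0 * (1 + u).
  by apply: len => /=; move: m4; rewrite ler_norml subr0 => /andP[_]; lra.
have l3 : segment_length (x.1, S / x.2) (- x.2, 0) <= 2 * c0 * (1 + u).
  apply: len => /=; move: m3; rewrite ler_norml sub0r sqrrN => /andP[_].
  by rewrite -[in X in _ -> X](sqrrN (- x.2 - x.1)) opprB opprK; lra.
have E0 p r : 0 <= side_mean p r f.
  by rewrite /side_mean /unit_int; apply: Rintegral_ge0 => t _; exact: sqr_ge0.
have bs : boundary_form (base_triangle x.2 x.1 (S / x.2)) f <= 2 * c0 * (1 + u) * side_sum x.2 x.1 (S / x.2) f.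
  rewrite /boundary_form /side_sum /=; move: l1 l2 l3.
  move: (2 * c0 * (1 + u)) => L l1 l2 l3; rewrite !mulrDr.
  apply: lerD; first apply: lerD.
  - exact: (ler_wpM2r (E0 _ _) l1).
  - exact: (ler_wpM2r (E0 _ _) l2).
  - exact: (ler_wpM2r (E0 _ _) l3).
have B0 : 0 <= boundary_form (base_triangle x.2 x.1 (S / x.2)) f.
  by apply: addr_ge0; [apply: addr_ge0|]; apply: mulr_ge0; rewrite ?segment_length_ge0 ?E0.
have SS0 : 0 <= side_sum x.2 x.1 (S / x.2) f by apply: addr_ge0; [apply: addr_ge0|]; exact: E0.
move: bs B0 SS0; set B := boundary_form _ _; set Q := side_sum _ _ _ _ => bs B0 SS0.
have [u1|u1] := leP 1 u.
  apply: (@le_trans _ _ 0).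
    by apply: mulr_le0_ge0 => //; apply: mulr_ge0_le0; [exact: ltW|rewrite subr_le0].
  by apply: mulr_ge0 => //; rewrite ltW// !mulr_gt0.
apply: (@le_trans _ _ (s * (1 - u) * (2 * c0 * (1 + u) * Q))).
  by apply: ler_wpM2l => //; rewrite mulr_ge0 ?ltW// subr_gt0.
have -> : s * (1 - u) * (2 * c0 * (1 + u) * Q) = (2 * c0 * s * Q) * (1 - u ^+ 2) by ring.
apply: ler_piMr; first by apply: mulr_ge0 => //; rewrite ltW// !mulr_gt0.
by rewrite lerBlDr lerDl sqr_ge0.
Unshelve. all: by end_near.
Qed.

End one_parameter.
End area_family.

(** * The perimeter *)

Section perimeter.
Context {R : realType}.
Variable S : R.
Hypothesis hS : 0 < S.
Local Notation c0 := (c_eq S).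

Lemma area_eq : S = Num.sqrt 3 * c0 ^+ 2.
Proof.
have c0p := c_eq_gt0 hS; have := height_eq hS => h.
by rewrite expr2 mulrA -h divfK// gt_eqF.
Qed.

Lemma sqrt_ge (z w : R) : z ^+ 2 <= w -> z <= Num.sqrt w.
Proof.
move=> zw; apply: le_trans (ler_norm z) _; rewrite -sqrtr_sqr ler_wsqrtr//.
Qed.

(** The tangent to the square root at w ^ 2. *)
Lemma sqrt_le (z w : R) : 0 < w -> 0 <= z -> Num.sqrt z <= (z + w ^+ 2) / (2 * w).
Proof.
move=> w0 z0; rewrite ler_pdivlMr ?mulr_gt0//.
have := sqr_ge0 (Num.sqrt z - w); have := sqr_sqrtr z0; set y := Num.sqrt z => e h.
rewrite -e; lra.
Qed.

Lemma perimeter_OmegaE (a c : R) : 0 < c -> perimeter (Omega S a c) =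
  2 * c + Num.sqrt ((a - c) ^+ 2 + (S / c) ^+ 2) + Num.sqrt ((a + c) ^+ 2 + (S / c) ^+ 2).
Proof.
move=> cp; rewrite /perimeter /segment_length /=; congr (_ + Num.sqrt _ + Num.sqrt _); try ring.
rewrite (_ : _ + _ = (2 * c) ^+ 2); last by ring.
by rewrite sqrtr_sqr gtr0_norm// mulr_gt0.
Qed.

(** Each slanted side is at least as long as its projection on the corresponding
    side of the equilateral triangle, and the sum of the projections is bounded
    below by the inequality of arithmetic and geometric means. *)
Lemma perimeter_ge (a c : R) : 0 < c -> 6 * c0 <= perimeter (Omega S a c).
Proof.
move=> cp; have c0p := c_eq_gt0 hS; rewrite perimeter_OmegaE//.
set h := S / c; pose r := Num.sqrt (3 : R); have r2 : r ^+ 2 = 3 by rewrite sqr_sqrtr.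
have r3 : 1 - r ^+ 2 / 3 = 0 by rewrite r2; field.
have rh : r * h = 3 * c0 ^+ 2 / c by rewrite /h {1}area_eq -/r mulrA mulrA -expr2 r2.
(* (1 / 2, sqrt 3 / 2) is the unit vector of a side of the equilateral triangle. *)
have s1 : (c - a) / 2 + r / 2 * h <= Num.sqrt ((a - c) ^+ 2 + h ^+ 2).
  apply: sqrt_ge; rewrite -subr_ge0.
  rewrite (_ : _ - _ = ((r / 2 * (c - a) - h / 2) ^+ 2)
     + (1 - r ^+ 2 / 3) * ((c - a) ^+ 2 * 3 / 4 + h ^+ 2 *3/4)); last by field.
  by rewrite r3 mul0r addr0 sqr_ge0.
have s2 : (c + a) / 2 + r / 2 * h <= Num.sqrt ((a + c) ^+ 2 + h ^+ 2).
  apply: sqrt_ge; rewrite -subr_ge0.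
  rewrite (_ : _ - _ = ((r / 2 * (c + a) - h / 2) ^+ 2)
     + (1 - r ^+ 2 / 3) * ((c + a) ^+ 2 * 3 / 4 + h ^+ 2 *3/4)); last by field.
  by rewrite r3 mul0r addr0 sqr_ge0.
have s3 : 6 * c0 <= 3 * c + r * h.
  rewrite rh -subr_ge0 (_ : _ - _ = 3 * (c - c0) ^+ 2 / c); last by field; rewrite (gt_eqF cp).
  by apply: divr_ge0; [apply: mulr_ge0 => //; exact: sqr_ge0|exact: ltW].
lra.
Qed.

Lemma perimeter_Omega0 : perimeter (Omega0 S) = 6 * c0.
Proof.
have c0p := c_eq_gt0 hS; rewrite /Omega0 perimeter_OmegaE// sub0r add0r sqrrN (height_sq hS).
rewrite (_ : _ + 3 * _ = (2 * c0) ^+ 2); last by ring.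
by rewrite sqrtr_sqr gtr0_norm ?mulr_gt0//; ring.
Qed.

(** The square roots are replaced by their tangents at the equilateral triangle;
    the remaining rational function of c has a double zero at c_eq S. *)
Lemma perimeter_le (a c : R) : c0 / 2 <= c -> c <= 2 * c0 ->
  perimeter (Omega S a c) <= 6 * c0 + 42 / c0 * (a ^+ 2 + (c - c0) ^+ 2).
Proof.
move=> c1 c2; have c0p := c_eq_gt0 hS; have cp : 0 < c by lra.
rewrite perimeter_OmegaE//.
have hh : (S / c) ^+ 2 = 3 * c0 ^+ 4 / c ^+ 2 by rewrite exprMn exprVn (area_sq hS).
have q1 := @sqrt_le ((a - c) ^+ 2 + (S / c) ^+ 2) (2 * c0) ltac:(by rewrite mulr_gt0) ltac:(by rewrite addr_ge0// sqr_ge0).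
have q2 := @sqrt_le ((a + c) ^+ 2 + (S / c) ^+ 2) (2 * c0) ltac:(by rewrite mulr_gt0) ltac:(by rewrite addr_ge0// sqr_ge0).
apply: (@le_trans _ _ (2 * c + ((a - c) ^+ 2 + (S / c) ^+ 2 + (2 * c0) ^+ 2) / (2 * (2 * c0)) +
   ((a + c) ^+ 2 + (S / c) ^+ 2 + (2 * c0) ^+ 2) / (2 * (2 * c0)))); first by lra.
rewrite hh.
have -> : 2 * c + ((a - c) ^+ 2 + 3 * c0 ^+ 4 / c ^+ 2 + (2 * c0) ^+ 2) / (2 * (2 * c0)) +
   ((a + c) ^+ 2 + 3 * c0 ^+ 4 / c ^+ 2 + (2 * c0) ^+ 2) / (2 * (2 * c0)) =
   6 * c0 + (a ^+ 2 + (c - c0) ^+ 2 * ((c ^+ 2 + 6 * c0 * c + 3 * c0 ^+ 2) / c ^+ 2)) / (2 * c0).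
  by field; rewrite (gt_eqF c0p) (gt_eqF cp).
rewrite lerD2l ler_pdivrMr ?mulr_gt0//.
have -> : 42 / c0 * (a ^+ 2 + (c - c0) ^+ 2) * (2 * c0) = 84 * (a ^+ 2 + (c - c0) ^+ 2).
  by field; rewrite (gt_eqF c0p).
have hf : (c ^+ 2 + 6 * c0 * c + 3 * c0 ^+ 2) / c ^+ 2 <= 84.
  by rewrite ler_pdivrMr ?exprn_gt0//; nra.
have := ler_wpM2l (sqr_ge0 (c - c0)) hf; have := sqr_ge0 a; lra.
Qed.

Lemma gamma_bounds (a c : R) : c0 / 2 <= c -> c <= 2 * c0 ->
  [/\ 0 < gamma S a c, gamma S a c <= 1 & 1 - gamma S a c <= 7 / c0 ^+ 2 * (a ^+ 2 + (c - c0) ^+ 2)].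
Proof.
move=> c1 c2; have c0p := c_eq_gt0 hS; have cp : 0 < c by lra.
have p1 := perimeter_ge a cp; have p2 := perimeter_le a c1 c2.
rewrite /gamma perimeter_Omega0; set P := perimeter _ in p1 p2 *.
have P0 : 0 < P by lra.
split; first by rewrite divr_gt0// mulr_gt0.
  by rewrite ler_pdivrMr// mul1r.
set D := a ^+ 2 + (c - c0) ^+ 2 in p2 *.
have D0 : 0 <= D by apply: addr_ge0; exact: sqr_ge0.
rewrite (_ : 1 - _ = (P - 6 * c0) / P); last by field; rewrite (gt_eqF P0).
rewrite ler_pdivrMr//; apply: (@le_trans _ _ (42 / c0 * D)); first by lra.
have -> : 42 / c0 * D = 7 / c0 ^+ 2 * D * (6 * c0) by field; rewrite (gt_eqF c0p).
by apply: ler_wpM2l => //; rewrite mulr_ge0// divr_ge0// exprn_ge0// ltW.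
Qed.

End perimeter.

(** * Fixed perimeter *)

Theorem corollary3p3 (R : realType) (S alpha0 : R) (hS : 0 < S) (halpha0 : alpha0 < 0)
  (hmax : forall alpha : R, alpha0 <= alpha -> alpha < 0 ->
     strict_local_max_area S alpha /\
     exists eps : R, exists C : R, 0 < eps /\ 0 < C /\
       forall a c : R, 0 < c -> `|a| + `|c - c_eq S| < eps ->
         (lambda1 alpha (Omega S a c) <=
          lambda1 alpha (Omega0 S) - (C * (a ^+ 2 + (c - c_eq S) ^+ 2))%:E)%E) :
  forall alpha : R, alpha0 < alpha -> alpha < 0 -> strict_local_max_perimeter S alpha.
Proof.
move=> alpha ha0 ha; have [_ [eps [C [eps0 [C0 hquad]]]]] := hmax alpha (ltW ha0) ha.
set c0 := c_eq S in hquad *; have c0p : 0 < c0 := c_eq_gt0 hS; have h0p := height_gt0 hS.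
have sq_gt0 (x : R) : 0 < x -> 0 < x ^+ 2 by move=> x0; exact: exprn_gt0.
pose s := - alpha; have s0 : 0 < s by rewrite /s oppr_gt0.
have [rho [kap [q [[r0 r1 kap0] hq1 hq2 hs hrob]]]] := ground_params hS s0.
pose k2 := s ^+ 2 / rho ^+ 2; have k20 : 0 < k2 by rewrite divr_gt0 ?exprn_gt0.
have lam0 : lambda1 alpha (Omega0 S) = (- k2)%:E.
  have := lambda1_equilateral hq1 hq2 c0p h0p (height_sq hS).
  by rewrite hs (kap_sq hS r0 hs) /s opprK.
pose K1 := 7 / c0 ^+ 2; have K10 : 0 < K1 by rewrite divr_gt0 ?exprn_gt0.
(* eta is small enough for the first-order excess 2 * eta * s * K1 / rho ^ 2,
   which comes from comparing s with s', to cost a quarter of C. *)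
pose eta := C * rho ^+ 2 / (8 * s * K1).
have eta0 : 0 < eta by apply: divr_gt0; apply: mulr_gt0 => //; [exact: sq_gt0|exact: mulr_gt0].
pose s' := s + eta; have s'0 : 0 < s' by rewrite addr_gt0.
have [rho' [kap' [q' [[r0' r1' kap0'] hq1' hq2' hs' hrob']]]] := ground_params hS s'0.
have rr : rho < rho'.
  apply: robin_param_lt_inv => //; rewrite hrob hrob'.
  by rewrite ltr_pM2r ?invr_gt0// ltr_pM2r ?exprn_gt0// /s' ltrDl.
(* K exceeds (s + s') / rho ^ 2, which bounds the slope of - lambda1 between s
   and s', and u is the error that uses up this margin. *)
pose K := (2 * s + 2 * eta) / rho ^+ 2.
have K0 : 0 < K by rewrite divr_gt0 ?exprn_gt0// addr_gt0// mulr_gt0.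
have Ks0 : 0 < 1 + K * s' by rewrite addr_gt0// mulr_gt0.
pose u := eta ^+ 2 / rho ^+ 2 / (1 + K * s').
have u0 : 0 < u by rewrite !divr_gt0 ?exprn_gt0.
have k2' : s' ^+ 2 / rho' ^+ 2 <= s' ^+ 2 / rho ^+ 2.
  rewrite ler_pM2l ?exprn_gt0// lef_pV2 ?posrE ?exprn_gt0//.
  by rewrite ler_sqr ?nnegrE ?ltW.
have gap : s' ^+ 2 / rho ^+ 2 + u - k2 = K * (eta - s' * u).
  have hu : u = eta ^+ 2 / rho ^+ 2 - K * s' * u.
    by rewrite /u; field; rewrite (gt_eqF Ks0) (gt_eqF r0).
  by rewrite {1}hu /k2 /K /s'; field; rewrite (gt_eqF r0).
have gap0 : 0 < eta - s' * u.
  rewrite -(pmulr_rgt0 _ K0) -gap /k2 /s'.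
  have -> : (s + eta) ^+ 2 / rho ^+ 2 + u - s ^+ 2 / rho ^+ 2 = eta * (2 * s + eta) / rho ^+ 2 + u.
    by field; rewrite (gt_eqF r0).
  by rewrite addr_gt0// divr_gt0 ?exprn_gt0// mulr_gt0// addr_gt0// mulr_gt0.
(* Below dmax the second-order term k2 * (1 - gamma) ^ 2 costs at most a quarter
   of C * D, where D is the squared distance to the equilateral triangle. *)
pose dmax := C / (4 * k2 * K1 ^+ 2).
have dmax0 : 0 < dmax.
  by apply: divr_gt0 => //; apply: mulr_gt0; [exact: mulr_gt0|exact: sq_gt0].
have nb := near_barta hS r0' kap0' hq1' hq2' hs' u0.
have cabs : {for ((0 : R), c0), continuous (fun x : R * R => `|x.1| + `|x.2 - c0|)}.
  by apply: cvgD; apply: cvg_norm; [exact: continuous_fst2|apply: cvgB; [exact: continuous_snd2|exact: cvg_cst]].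
have csq : {for ((0 : R), c0), continuous (fun x : R * R => x.1 ^+ 2 + (x.2 - c0) ^+ 2)}.
  apply: cvgD; first exact: (continuous_sqr (@continuous_fst2 R)).
  apply: (@continuous_sqr _ _ (fun x : R * R => x.2 - c0)) => x.
  by apply: cvgB; [exact: continuous_snd2|exact: cvg_cst].
have n1 : \forall x \near ((0 : R), c0), `|x.1| + `|x.2 - c0| < eps.
  by apply: (cvgr_lt _ cabs); rewrite /= normr0 subrr normr0 addr0.
have n2 : \forall x \near ((0 : R), c0), x.1 ^+ 2 + (x.2 - c0) ^+ 2 < dmax.
  by apply: (cvgr_lt _ csq); rewrite /= subrr expr0n addr0.
have n3 : \forall x \near ((0 : R), c0), c0 / 2 < x.2.
  by apply: (cvgr_gt _ (@continuous_snd2 R (0, c0))) => /=; lra.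
have n4 : \forall x \near ((0 : R), c0), x.2 < 2 * c0.
  by apply: (cvgr_lt _ (@continuous_snd2 R (0, c0))) => /=; lra.
rewrite /strict_local_max_perimeter /strict_local_maximiser -/c0 lam0.
near=> x => x2 xneq.
have m1 : `|x.1| + `|x.2 - c0| < eps by near: x.
have m2 : x.1 ^+ 2 + (x.2 - c0) ^+ 2 < dmax by near: x.
have m3 : c0 / 2 < x.2 by near: x.
have m4 : x.2 < 2 * c0 by near: x.
have mb : 0 < x.2 -> forall f, smooth f ->
    s' * (1 - u) * boundary_form (base_triangle x.2 x.1 (S / x.2)) f
      - (s' ^+ 2 / rho' ^+ 2 + u) * mass x.2 x.1 (S / x.2) f <= energy x.2 x.1 (S / x.2) f.
  by near: x.
have [g0 g1 ge] := gamma_bounds hS x.1 (ltW m3) (ltW m4).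
set D := x.1 ^+ 2 + (x.2 - c0) ^+ 2 in m2 ge *.
have D0 : 0 < D.
  rewrite lt0r addr_ge0 ?sqr_ge0// andbT; apply: contra xneq.
  rewrite paddr_eq0 ?sqr_ge0// !sqrf_eq0 subr_eq0 => /andP[/eqP e1 /eqP e2].
  by rewrite [x]surjective_pairing e1 e2.
set g := gamma S x.1 x.2 in g0 g1 ge *.
have hx : 0 < S / x.2 by rewrite divr_gt0.
have lamT : (lambda1 alpha (base_triangle x.2 x.1 (S / x.2)) < (- k2 - C * D / 2)%:E)%E.
  apply: (le_lt_trans (hquad x.1 x.2 x2 m1)).
  rewrite lam0 -/D -EFinB lte_fin ltrD2l ltrN2.
  by rewrite ltr_pdivrMr// ltr_pMr ?ltr1n// mulr_gt0.
have [f [sf M0 hf]] := smooth_below x2 hx lamT.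
apply: (lambda1_dilate g0 x2 hx sf M0).
have {mb} := mb x2 f sf; move: hf M0.
set En := energy _ _ _ _; set B := boundary_form _ _; set M := mass _ _ _ _.
rewrite -[alpha](opprK alpha) -/s => hf M0 hb.
have CD0 : 0 < C * D by rewrite mulr_gt0.
(* The near-minimiser f for s also satisfies Barta's inequality for s'. The
   difference of the two bounds its boundary integral. *)
have BM : B <= K * M.
  rewrite -(ler_pM2l gap0).
  have : (s' ^+ 2 / rho' ^+ 2 + u) * M <= (s' ^+ 2 / rho ^+ 2 + u) * M.
    by rewrite ler_pM2r// lerD2r.
  have CM : 0 <= C * D / 2 * M by rewrite ltW// mulr_gt0// divr_gt0.
  have -> : (eta - s' * u) * (K * M) = (s' ^+ 2 / rho ^+ 2 + u - k2) * M by rewrite gap; ring.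
  rewrite /s' in hb *; lra.
pose e := 1 - g; have eE : g = 1 - e by rewrite /e; ring.
have e0 : 0 <= e by rewrite subr_ge0.
have eD : e <= K1 * D by [].
have b1 : k2 * e ^+ 2 <= C * D / 4.
  have : e ^+ 2 <= (K1 * D) ^+ 2 by rewrite ler_sqr ?nnegrE// mulr_ge0// ltW.
  move=> h1; apply: (le_trans (ler_wpM2l (ltW k20) h1)).
  have h2 : D * (4 * k2 * K1 ^+ 2) <= C.
    rewrite -ler_pdivlMr; first exact: ltW.
    by apply: mulr_gt0; [exact: mulr_gt0|exact: sq_gt0].
  by have := ler_wpM2r (ltW D0) h2; lra.
have b2 : 2 * eta * s / rho ^+ 2 * e <= C * D / 4.
  have -> : 2 * eta * s / rho ^+ 2 = C / (4 * K1).
    by rewrite /eta; field; rewrite (gt_eqF r0) (gt_eqF K10) (gt_eqF s0).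
  have h1 : 0 <= C / (4 * K1).
    by apply: divr_ge0; [exact: ltW|apply: mulr_ge0 => //; exact: ltW].
  apply: (le_trans (ler_wpM2l h1 eD)).
  by rewrite le_eqVlt; apply/orP; left; apply/eqP; field; rewrite (gt_eqF K10).
have sK : s * K = 2 * k2 + 2 * eta * s / rho ^+ 2 by rewrite /K /k2; field; rewrite (gt_eqF r0).
have eB : e * s * B <= e * s * (K * M) by rewrite ler_wpM2l// mulr_ge0// ltW.
(* Dilation costs e * s * B <= e * s * K * M in the boundary term and gains
   k2 * (1 - (1 - e) ^ 2) * M through the area; at first order in e the two
   cancel, and C * D / 2 pays for the rest. *)
have main : e * (s * K) - k2 - C * D / 2 <= - k2 * (1 - e) ^+ 2.
  rewrite sK; lra.
have := ler_wpM2r (ltW M0) main; rewrite eE; lra.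
Unshelve. all: by end_near.
Qed.
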